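(* Let $H$ be a Hopf algebra with invertible antipode over a field $k$ of characteristic $0$. The category of stable anti-Yetter-Drinfeld modules over $H$ is equivalent to $\mathcal{Z}'_{\mathcal{M}^H}(\mathcal{M}^{H\,op})$, the full subcategory of the center $\mathcal{Z}_{\mathcal{M}^H}(\mathcal{M}^{H\,op})$ consisting of the objects $(M,\tau)$ such that $Id_M\in\mathrm{Hom}(M,M)^H$ is mapped to itself under the composite $$\mathrm{Hom}(M,M)^H\simeq\mathrm{Hom}(k,M\triangleright M)^H\simeq\mathrm{Hom}(k,M\triangleleft M)^H\simeq\mathrm{Hom}(M,M)^H,$$ where the middle isomorphism is composition with $\tau_M$ and the outer ones are the internal Hom adjunctions.
   Context: Sweedler notation: $\Delta(h)=h^1\otimes h^2$, $(\Delta\otimes 1)\Delta(h)=h^1\otimes h^2\otimes h^3$; a right coaction is $m\mapsto m_0\otimes m_1$. $S$ is the antipode. $\mathcal{M}^H$ is the monoidal category of right $H$-comodules with coaction $m_0\otimes n_0\otimes m_1n_1$ on $M\otimes N$, and unit the trivial comodule $k$; $\mathrm{Hom}$ denotes $k$-linear maps, $\mathrm{Hom}(-,-)^H$ comodule maps. Anti-Yetter-Drinfeld ($aYD$) module: a left $H$-module and right $H$-comodule $M$ with $(hm)_0\otimes(hm)_1=h^2m_0\otimes h^3m_1S(h^1)$ for all $h\in H$, $m\in M$; morphisms are $H$-linear and $H$-colinear maps. It is stable ($saYD$) if $m_1m_0=m$ for all $m\in M$. Internal Homs: for $W,V\in\mathcal{M}^H$ and $f\in\mathrm{Hom}(W,V)$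 put $\rho^lf(w)=f(w_0)_0\otimes f(w_0)_1S(w_1)$ and $\rho^rf(w)=f(w_0)_0\otimes S^{-1}(w_1)f(w_0)_1$, elements of $\mathrm{Hom}(W,V\otimes H)$. $\mathrm{Hom}^l(W,V)$ (resp. $\mathrm{Hom}^r(W,V)$) is the subspace of $f$ with $\rho^lf$ (resp. $\rho^rf$) in $\mathrm{Hom}(W,V)\otimes H$; these are $H$-comodules with coactions $\rho^l$, $\rho^r$, and $\mathrm{Hom}(T\otimes W,V)^H\simeq\mathrm{Hom}(T,\mathrm{Hom}^l(W,V))^H$, $\mathrm{Hom}(W\otimes T,V)^H\simeq\mathrm{Hom}(T,\mathrm{Hom}^r(W,V))^H$. Opposite bimodule category $\mathcal{M}^{H\,op}$: it has left action $W\triangleright V=\mathrm{Hom}^l(W,V)$ and right action $V\triangleleft W=\mathrm{Hom}^r(W,V)$ of $\mathcal{M}^H$, with the associativity identifications $(W\otimes V)\triangleright M\simeq W\triangleright(V\triangleright M)$, $(M\triangleleft W)\triangleleft V\simeq M\triangleleft (W\otimes V)$, $W\triangleright(M\triangleleft V)\simeq (W\triangleright M)\triangleleft V$ induced by the adjunctions (currying). Center: an object of $\mathcal{Z}_{\mathcal{M}^H}(\mathcal{M}^{H\,op})$ is a comodule $M$ together with isomorphisms $\tau_W:W\triangleright M\to M\triangleleft W$ in $\mathcal{M}^H$, natural in $W\in\mathcal{M}^H$, such that $\tau_k$ is the identity of $M$ and such that, under the associativity identifications, $\tau_{W\otimes V}$ equals the composite $W\triangleright(V\triangleright M)\xrightarrow{Id\triangleright\tau_V}W\triangleright(M\triangleleft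 V)\simeq(W\triangleright M)\triangleleft V\xrightarrow{\tau_W\triangleleft Id}(M\triangleleft W)\triangleleft V$. Morphisms $(M,\tau)\to(M',\tau')$ are comodule maps $\theta:M\to M'$ with $(\theta\circ-)\circ\tau_W=\tau'_W\circ(\theta\circ -)$ for all $W$. *)

(* Defs.v *)
From HB Require Import structures.
From mathcomp Require Import all_boot all_algebra.
From mathcomp Require Import boolp classical_sets.

Set Implicit Arguments.
Unset Strict Implicit.
Unset Printing Implicit Defensive.
Import GRing.Theory.
Local Open Scope ring_scope.
Local Open Scope quotient_scope.

Section Linear.
Variable k : fieldType.
Implicit Types U V W : lmodType k.

Definition mklin U V (f : U -> V) (hf : linear f) : {linear U -> V} :=
  HB.pack f (GRing.isLinear.Build k U V *:%R f hf).

Lemma linear_eq U V (f g : {linear U -> V}) : f =1 g -> f = g.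
Proof.
move=> fg; have {fg}: (f : U -> V) = g by apply: funext.
case: f g => [f [[f1] [f2]]] [g [[g1] [g2]]] /= fg.
subst g.
by rewrite (Prop_irrelevance f1 g1) (Prop_irrelevance f2 g2).
Qed.

Definition bilin U V W (F : U -> V -> W) : Prop :=
  (forall v, linear (fun u => F u v)) /\ (forall u, linear (F u)).
End Linear.

Section HomSpace.
Variables (k : fieldType) (U V : lmodType k).

HB.instance Definition _ := gen_eqMixin {linear U -> V}.
HB.instance Definition _ := gen_choiceMixin {linear U -> V}.

Fact add_lin_subproof (f g : {linear U -> V}) : linear (fun x => f x + g x).
Proof. by move=> a u v; rewrite !linearP scalerDr addrACA. Qed.
Fact opp_lin_subproof (f : {linear U -> V}) : linear (fun x => - f x).
Proof. by move=> a u v; rewrite linearP opprD scalerN. Qed.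
Fact scale_lin_subproof (c : k) (f : {linear U -> V}) :
  linear (fun x => c *: f x).
Proof. by move=> a u v; rewrite linearP scalerDr !scalerA mulrC. Qed.
Fact zero_lin_subproof : linear (fun _ : U => 0 : V).
Proof. by move=> a u v; rewrite scaler0 addr0. Qed.

Fact lin_addA : associative
  (fun f g : {linear U -> V} => mklin (add_lin_subproof f g)).
Proof. by move=> f g h; apply: linear_eq => x /=; rewrite addrA. Qed.
Fact lin_addC : commutative
  (fun f g : {linear U -> V} => mklin (add_lin_subproof f g)).
Proof. by move=> f g; apply: linear_eq => x /=; rewrite addrC. Qed.
Fact lin_add0 : left_id (mklin zero_lin_subproof)
  (fun f g : {linear U -> V} => mklin (add_lin_subproof f g)).
Proof. by move=> f; apply: linear_eq => x /=; rewrite add0r. Qed.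
Fact lin_addN : left_inverse (mklin zero_lin_subproof)
  (fun f => mklin (opp_lin_subproof f))
  (fun f g : {linear U -> V} => mklin (add_lin_subproof f g)).
Proof. by move=> f; apply: linear_eq => x /=; rewrite addNr. Qed.

HB.instance Definition _ := GRing.isZmodule.Build {linear U -> V}
  lin_addA lin_addC lin_add0 lin_addN.

Lemma lin_addE (f g : {linear U -> V}) x : (f + g) x = f x + g x.
Proof. by []. Qed.

Fact lin_scaleA (a b : k) (f : {linear U -> V}) :
  mklin (scale_lin_subproof a (mklin (scale_lin_subproof b f)))
  = mklin (scale_lin_subproof (a * b) f).
Proof. by apply: linear_eq => x /=; rewrite scalerA. Qed.
Fact lin_scale1 : left_id 1 (fun c f => mklin (scale_lin_subproof c f)).
Proof. by move=> f; apply: linear_eq => x /=; rewrite scale1r. Qed.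
Fact lin_scaleDr : right_distributive
  (fun c (f : {linear U -> V}) => mklin (scale_lin_subproof c f)) +%R.
Proof. by move=> a f g; apply: linear_eq => x /=; rewrite scalerDr. Qed.
Fact lin_scaleDl (f : {linear U -> V}) :
  {morph (fun c => mklin (scale_lin_subproof c f)) : a b / a + b}.
Proof. by move=> a b; apply: linear_eq => x /=; rewrite scalerDl. Qed.

HB.instance Definition _ := GRing.Zmodule_isLmodule.Build k {linear U -> V}
  lin_scaleA lin_scale1 lin_scaleDr lin_scaleDl.

Lemma lin_scaleE (c : k) (f : {linear U -> V}) x : (c *: f) x = c *: f x.
Proof. by []. Qed.
End HomSpace.

Section Tensor.
Variables (k : fieldType) (A B : lmodType k).

(* Formal finite sums of pairs, up to the congruence of additive monoids
   generated by the bilinearity relations; [tens A B] is the quotient. *)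
Inductive tens_rel : seq (A * B) -> seq (A * B) -> Prop :=
| tens_refl s : tens_rel s s
| tens_sym s t : tens_rel s t -> tens_rel t s
| tens_trans s t u : tens_rel s t -> tens_rel t u -> tens_rel s u
| tens_cat s s' t t' : tens_rel s t -> tens_rel s' t' ->
    tens_rel (s ++ s') (t ++ t')
| tens_catC s t : tens_rel (s ++ t) (t ++ s)
| tens_addl a a' b : tens_rel [:: (a + a', b)] [:: (a, b); (a', b)]
| tens_addr a b b' : tens_rel [:: (a, b + b')] [:: (a, b); (a, b')]
| tens_scale c a b : tens_rel [:: (c *: a, b)] [:: (a, c *: b)]
| tens_zero b : tens_rel [:: (0, b)] [::].

Definition tens_eqb : rel (seq (A * B)) := fun s t => `[< tens_rel s t >].

Fact tens_eqb_refl : reflexive tens_eqb.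
Proof. by move=> s; apply/asboolP; constructor. Qed.
Fact tens_eqb_sym : symmetric tens_eqb.
Proof. by move=> s t; apply/asboolP/asboolP; exact: tens_sym. Qed.
Fact tens_eqb_trans : transitive tens_eqb.
Proof.
by move=> s t u /asboolP ts /asboolP su; apply/asboolP; exact: tens_trans su.
Qed.

Canonical tens_equiv : equiv_rel (seq (A * B)) :=
  EquivRel tens_eqb tens_eqb_refl tens_eqb_sym tens_eqb_trans.

Definition tens := {eq_quot tens_equiv}.
HB.instance Definition _ := Choice.on tens.
HB.instance Definition _ := Quotient.on tens.

Definition tpi (s : seq (A * B)) : tens := \pi s.

Definition ten (a : A) (b : B) : tens := tpi [:: (a, b)].

Lemma pi_tensP s t : tpi s = tpi t <-> tens_rel s t.
Proof.
by split=> [/eqmodP/asboolP|st]; last by apply/eqmodP/asboolP.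
Qed.
Lemma repr_tens s : tens_rel (repr (tpi s)) s.
Proof. by apply/pi_tensP; rewrite /tpi reprK. Qed.

Lemma tensW (P : tens -> Prop) : (forall s, P (tpi s)) -> forall x, P x.
Proof. by move=> h x; have := h (repr x); rewrite /tpi reprK. Qed.

Definition tens_zero_elt : tens := tpi [::].
Definition tens_add (x y : tens) : tens := tpi (repr x ++ repr y).
Definition tens_scal (c : k) (x : tens) : tens :=
  tpi [seq (c *: p.1, p.2) | p <- repr x].
Definition tens_opp (x : tens) : tens := tens_scal (-1) x.

Lemma tens_addE s t : tens_add (tpi s) (tpi t) = tpi (s ++ t).
Proof. by apply/pi_tensP; apply: tens_cat; exact: repr_tens. Qed.

Lemma tens_scalE c s :
  tens_scal c (tpi s) = tpi [seq (c *: p.1, p.2) | p <- s].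
Proof.
apply/pi_tensP; move: (repr_tens s); move: (repr _) => r.
elim=> /=.
- by move=> ?; exact: tens_refl.
- by move=> *; exact: tens_sym.
- by move=> ? ? ? _ h1 _; exact: tens_trans.
- by move=> ? ? ? ? _ h1 _ h2; rewrite !map_cat; exact: tens_cat.
- by move=> ? ?; rewrite !map_cat; exact: tens_catC.
- by move=> *; rewrite scalerDr; exact: tens_addl.
- by move=> *; exact: tens_addr.
- by move=> d a b; rewrite scalerA mulrC -scalerA; exact: tens_scale.
- by move=> b; rewrite scaler0; exact: tens_zero.
Qed.

Fact tens_addA : associative tens_add.
Proof. by elim/tensW=> s; elim/tensW=> t; elim/tensW=> u; rewrite !tens_addE catA. Qed.
Fact tens_addC : commutative tens_add.
Proof.
elim/tensW=> s; elim/tensW=> t; rewrite !tens_addE; apply/pi_tensP.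
exact: tens_catC.
Qed.
Fact tens_add0 : left_id tens_zero_elt tens_add.
Proof. by elim/tensW=> s; rewrite tens_addE. Qed.

Lemma rel_scaleD a b s : tens_rel [seq ((a + b) *: p.1, p.2) | p <- s]
  ([seq (a *: p.1, p.2) | p <- s] ++ [seq (b *: p.1, p.2) | p <- s]).
Proof.
elim: s => [|[u v] s IH] /=; first exact: tens_refl.
rewrite scalerDl; pose sa := [seq (a *: p.1, p.2) | p <- s].
pose sb := [seq (b *: p.1, p.2) | p <- s].
rewrite -(cat1s _ (map _ _)).
apply: tens_trans (tens_cat (tens_addl _ _ _) IH) _.
change (tens_rel ([:: (a *: u, v)] ++ ([:: (b *: u, v)] ++ sa ++ sb))
  ([:: (a *: u, v)] ++ (sa ++ [:: (b *: u, v)] ++ sb))).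
apply: tens_cat; first exact: tens_refl.
rewrite !catA; apply: tens_cat; last exact: tens_refl.
exact: tens_catC.
Qed.
Lemma rel_scale0 s : tens_rel [seq (0 *: p.1, p.2) | p <- s] [::].
Proof.
elim: s => [|[u v] s IH] /=; first exact: tens_refl.
rewrite scale0r -(cat1s (0, v)).
by apply: (tens_cat (tens_zero v) IH).
Qed.

Fact tens_addN : left_inverse tens_zero_elt tens_opp tens_add.
Proof.
elim/tensW=> s; rewrite /tens_opp tens_scalE tens_addE; apply/pi_tensP.
have {2}-> : s = [seq (1 *: p.1, p.2) | p <- s].
  by rewrite -[LHS]map_id; apply: eq_map => -[a b]; rewrite scale1r.
apply: tens_trans (tens_sym (rel_scaleD _ _ _)) _.
by rewrite addNr; exact: rel_scale0.
Qed.

HB.instance Definition _ :=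
  GRing.isZmodule.Build tens tens_addA tens_addC tens_add0 tens_addN.

Fact tens_scalA a b x : tens_scal a (tens_scal b x) = tens_scal (a * b) x.
Proof.
elim/tensW: x => s; rewrite !tens_scalE -map_comp; congr (tpi _).
by apply: eq_map => -[u v] /=; rewrite scalerA.
Qed.
Fact tens_scal1 : left_id 1 tens_scal.
Proof.
elim/tensW=> s; rewrite !tens_scalE -[in RHS](map_id s); congr (tpi _).
by apply: eq_map => -[u v] /=; rewrite scale1r.
Qed.
Lemma tens_addrE s t : tpi s + tpi t = tpi (s ++ t).
Proof. exact: tens_addE. Qed.
Fact tens_scalDr : right_distributive tens_scal +%R.
Proof.
move=> a; elim/tensW=> s; elim/tensW=> t.
by rewrite (tens_addrE s t) !tens_scalE tens_addrE map_cat.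
Qed.
Fact tens_scalDl x : {morph tens_scal^~ x : a b / a + b}.
Proof.
elim/tensW: x => s a b; rewrite !tens_scalE tens_addrE; apply/pi_tensP.
exact: rel_scaleD.
Qed.
HB.instance Definition _ := GRing.Zmodule_isLmodule.Build k tens
  tens_scalA tens_scal1 tens_scalDr tens_scalDl.

(* Sweedler notation: [\tsum_(a, b <- t) F a b] is the sum of [F a b] over a
   chosen representative of [t] as a finite sum of tensors [a ⊗ b].  It does not
   depend on that choice when [F] is bilinear: it is then the image of [t] under
   the linear map induced by [F] ([tsum_ten], [tsum_lin]).  [F] is bilinear
   wherever [tsum] is used in a definition. *)
Definition tsum (U : lmodType k) (t : tens) (F : A -> B -> U) : U :=
  \sum_(p <- repr t) F p.1 p.2.
End Tensor.

Arguments tpi {k A B} s : simpl never.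
Arguments ten {k A B} a b : simpl never.
Arguments tsum {k A B U} t F : simpl never.
Notation "a ⊗ b" := (ten a b) (at level 40, left associativity) : ring_scope.
Notation "\tsum_ ( a , b <- t ) F" := (tsum t (fun a b => F))
  (at level 41, a name, b name, t at level 99, F at level 41,
   format "'[' \tsum_ ( a ,  b  <-  t ) '/  '  F ']'") : ring_scope.

Section TensorTheory.
Variables (k : fieldType) (A B : lmodType k).
Implicit Types (t u : tens A B).

Lemma lin0 (U V : lmodType k) (f : U -> V) : linear f -> f 0 = 0.
Proof. by move=> hf; exact: (linear0 (mklin hf)). Qed.
Lemma linD (U V : lmodType k) (f : U -> V) : linear f -> {morph f : x y / x + y}.
Proof. by move=> hf; exact: (linearD (mklin hf)). Qed.
Lemma linZ (U V : lmodType k) (f : U -> V) : linear f ->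
  forall a, {morph f : x / a *: x}.
Proof. by move=> hf; exact: (linearZ_LR (mklin hf)). Qed.
Lemma lin_sum (U V : lmodType k) (f : U -> V) : linear f ->
  forall I r (P : pred I) E, f (\sum_(i <- r | P i) E i) = \sum_(i <- r | P i) f (E i).
Proof. by move=> hf; exact: (linear_sum (mklin hf)). Qed.

Lemma pi_tensE s : @tpi k A B s = \sum_(p <- s) p.1 ⊗ p.2.
Proof.
elim: s => [|[a b] s IH]; first by rewrite big_nil.
by rewrite big_cons -IH /ten tens_addrE.
Qed.

Lemma tens_repr t : t = \tsum_(a, b <- t) a ⊗ b.
Proof. by rewrite /tsum -pi_tensE /tpi reprK. Qed.

Lemma tenl (b : B) : linear (fun a : A => a ⊗ b).
Proof.
move=> c u v; rewrite /ten; have -> : c *: @tpi k A B [:: (u, b)] = @tpi k A B [:: (c *: u, b)].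
  exact: tens_scalE.
by rewrite tens_addrE; apply/pi_tensP; exact: tens_addl.
Qed.
Lemma tenr (a : A) : linear (fun b : B => a ⊗ b).
Proof.
move=> c u v; rewrite /ten; have -> : c *: @tpi k A B [:: (a, u)] = @tpi k A B [:: (a, c *: u)].
  by rewrite [LHS]tens_scalE; apply/pi_tensP; exact: tens_scale.
by rewrite tens_addrE; apply/pi_tensP; exact: tens_addr.
Qed.

Lemma sum_tens_rel (U : lmodType k) (F : A -> B -> U) : bilin F ->
  forall s s' : seq (A * B), tens_rel s s' ->
    \sum_(p <- s) F p.1 p.2 = \sum_(p <- s') F p.1 p.2.
Proof.
case=> Fl Fr s s'; elim=> //.
- by move=> ? ? ? _ -> _ ->.
- by move=> ? ? ? ? _ e _ e'; rewrite !big_cat /= e e'.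
- by move=> ? ?; rewrite !big_cat /= addrC.
- by move=> a a' b; rewrite !big_cons !big_nil !addr0 /= (linD (Fl _)).
- by move=> a b b'; rewrite !big_cons !big_nil !addr0 /= (linD (Fr _)).
- by move=> c a b; rewrite !big_cons !big_nil !addr0 /= (linZ (Fl _)) (linZ (Fr _)).
- by move=> b; rewrite !big_cons !big_nil addr0 /= (lin0 (Fl _)).
Qed.

Lemma tsum_pi (U : lmodType k) (F : A -> B -> U) s : bilin F ->
  tsum (@tpi k A B s) F = \sum_(p <- s) F p.1 p.2.
Proof. by move=> hF; apply: sum_tens_rel => //; exact: repr_tens. Qed.

(* Together, [tsum_ten] and [tsum_lin] are the existence half of the universal
   property of [tens A B], and [tens_ext] the uniqueness half. *)
Lemma tsum_ten (U : lmodType k) (F : A -> B -> U) a b : bilin F ->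
  tsum (a ⊗ b) F = F a b.
Proof. by move=> hF; rewrite /ten tsum_pi // big_seq1. Qed.

Lemma tsum_lin (U : lmodType k) (F : A -> B -> U) : bilin F ->
  linear (fun t => tsum t F).
Proof.
move=> hF c; elim/tensW=> s; elim/tensW=> t.
have -> : c *: @tpi k A B s = @tpi k A B [seq (c *: p.1, p.2) | p <- s].
  exact: tens_scalE.
rewrite tens_addrE !tsum_pi // big_cat /= big_map scaler_sumr; congr (_ + _).
by apply: eq_bigr => p _ /=; case: hF => Fl _; rewrite (linZ (Fl _)).
Qed.

Lemma tens_ext (U : lmodType k) (f g : tens A B -> U) : linear f -> linear g ->
  (forall a b, f (a ⊗ b) = g (a ⊗ b)) -> f =1 g.
Proof.
move=> hf hg e t; rewrite (tens_repr t) /tsum !(lin_sum hf) !(lin_sum hg).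
by apply: eq_bigr => p _; exact: e.
Qed.

Lemma eq_tsum (U : lmodType k) t (F G : A -> B -> U) :
  (forall a b, F a b = G a b) -> tsum t F = tsum t G.
Proof. by move=> e; apply: eq_bigr => p _; exact: e. Qed.

Lemma tsum_fun (U V : lmodType k) (f : U -> V) t (F : A -> B -> U) :
  linear f -> f (tsum t F) = \tsum_(a, b <- t) f (F a b).
Proof. by move=> hf; rewrite /tsum (lin_sum hf). Qed.

Lemma tsum_swap (A' B' U : lmodType k) t (u : tens A' B') (F : A -> B -> A' -> B' -> U) :
  \tsum_(a, b <- t) \tsum_(c, d <- u) F a b c d
  = \tsum_(c, d <- u) \tsum_(a, b <- t) F a b c d.
Proof. exact: exchange_big. Qed.

End TensorTheory.

Section LinTac.
Variable k : fieldType.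
Implicit Types U V W A B : lmodType k.
Lemma lin_id U : linear (fun x : U => x). Proof. by []. Qed.
Lemma lin_comp U V W (f : {linear V -> W}) (g : U -> V) :
  linear g -> linear (fun x => f (g x)).
Proof. by move=> hg a u v; rewrite hg linearP. Qed.
Lemma lin_compH U V W (f : V -> W) (g : U -> V) :
  linear f -> linear g -> linear (fun x => f (g x)).
Proof. by move=> hf hg a u v; rewrite hg hf. Qed.
Lemma lin_bill U V V' W (f : V -> V' -> W) (g : U -> V) v' :
  bilin f -> linear g -> linear (fun x => f (g x) v').
Proof. by move=> [hf _] hg a u v; rewrite hg hf. Qed.
Lemma lin_bilr U V V' W (f : V' -> V -> W) (g : U -> V) v' :
  bilin f -> linear g -> linear (fun x => f v' (g x)).
Proof. by move=> [_ hf] hg a u v; rewrite hg hf. Qed.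
Lemma lin_tenl U A B (g : U -> A) (b : B) :
  linear g -> linear (fun x => g x ⊗ b).
Proof. by move=> hg a u v; rewrite hg tenl. Qed.
Lemma lin_tenr U A B (g : U -> B) (a : A) :
  linear g -> linear (fun x => a ⊗ g x).
Proof. by move=> hg c u v; rewrite hg tenr. Qed.
Lemma lin_mull U (H : algType k) (g : U -> H) b :
  linear g -> linear (fun x => g x * b).
Proof. by move=> hg c u v; rewrite hg mulrDl scalerAl. Qed.
Lemma lin_mulr U (H : algType k) (g : U -> H) b :
  linear g -> linear (fun x => b * g x).
Proof. by move=> hg c u v; rewrite hg mulrDr scalerAr. Qed.
Lemma lin_scall U V W (e : {scalar V}) (g : U -> V) (w : W) :
  linear g -> linear (fun x => e (g x) *: w).
Proof. by move=> hg c u v; rewrite hg linearP scalerDl scalerA. Qed.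
Lemma lin_scalr U V (c : k) (g : U -> V) :
  linear g -> linear (fun x => c *: g x).
Proof. by move=> hg a u v; rewrite hg scalerDr !scalerA mulrC. Qed.
Lemma lin_app U V W (g : U -> {linear V -> W}) (v : V) :
  linear g -> linear (fun x => g x v).
Proof. by move=> hg a x y; rewrite hg. Qed.
Lemma lin_tsumt U A B W (g : U -> tens A B) (F : A -> B -> W) :
  linear g -> bilin F -> linear (fun x => tsum (g x) F).
Proof. by move=> hg hF a u v; rewrite hg (tsum_lin hF). Qed.
Lemma lin_tsumF U A B W (t : tens A B) (F : U -> A -> B -> W) :
  (forall a b, linear (fun x => F x a b)) -> linear (fun x => tsum t (F x)).
Proof.
move=> hF a u v; rewrite /tsum scaler_sumr -big_split /=.
by apply: eq_bigr => p _; rewrite hF.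
Qed.
End LinTac.

Create HintDb lin.
Ltac lin1 :=
  lazy beta;
  lazymatch goal with
  | |- bilin _ => split; intro
  | |- forall _, _ => intro
  | |- linear _ =>
    first [ exact: lin_id | solve [eauto 2 with lin nocore]
          | apply: lin_tenl | apply: lin_tenr
          | apply: lin_tsumF => ? ? | apply: lin_tsumt
          | apply: lin_mull | apply: lin_mulr
          | apply: lin_scall | apply: lin_scalr
          | apply: lin_comp | apply: lin_app ]
  end.
Ltac lin := repeat lin1.

Lemma tsumC (k : fieldType) (A B A' B' U : lmodType k) (t : tens A B)
  (F : A -> B -> tens A' B') (G : A' -> B' -> U) : bilin G ->
  tsum (tsum t F) G = \tsum_(a, b <- t) tsum (F a b) G.
Proof. by move=> hG; apply: (tsum_fun _ _ (tsum_lin hG)). Qed.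

Section Functional.
Variables (k : fieldType) (B : lmodType k) (Q : B -> Prop).
Hypotheses (Q0 : Q 0) (QL : forall a u v, Q u -> Q v -> Q (a *: u + v)).

Lemma functional b0 : ~ Q b0 ->
  exists phi : {scalar B}, (forall q, Q q -> phi q = 0) /\ phi b0 = 1.
Proof.
move=> nQ.
pose P (K : set B) := [/\ forall a u v, K u -> K v -> K (a *: u + v),
  ~ K b0 & (exists x, K x) -> forall q, Q q -> K q].
have [F FP tot|K [[KL Kb KQ] Kmax]] := @Zorn_bigcup B P.
  split.
  - move=> a u v [X FX Xu] [Y FY Yv].
    have [XY|YX] := tot _ _ FX FY.
    + by exists Y => //; case: (FP _ FY) => h _ _; apply: h => //; exact: XY.
    + by exists X => //; case: (FP _ FX) => h _ _; apply: h => //; exact: YX.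
  - by move=> [X FX Xb]; case: (FP _ FX).
  - move=> [x [X FX Xx]] q Qq; exists X => //.
    by case: (FP _ FX) => _ _; apply=> //; exists x.
have {KQ}KQ : forall q, Q q -> K q.
  apply: KQ; apply: contrapT => /forallNP nK.
  apply: (Kmax Q); last by split.
  by split=> [x /nK//|QK]; exact: (nK _ (QK _ Q0)).
have K0 : K 0 by exact: KQ.
have KZ c u : K u -> K (c *: u) by move=> Ku; rewrite -[_ *: _]addr0; exact: KL.
have ex y : exists c, K (y - c *: b0).
  have [Ky|nKy] := pselect (K y); first by exists 0; rewrite scale0r subr0.
  pose K' : set B := fun z => exists c u, K u /\ z = u + c *: y.
  have KK' : (K `<=` K')%classic.
    by move=> u Ku; exists 0, u; rewrite scale0r addr0.
  have : ~ P K'.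
    apply: Kmax; split=> // K'K; apply: nKy; apply: K'K.
    by exists 1, 0; rewrite scale1r add0r.
  apply: contra_notP => nex; split.
  - move=> a _ _ [c [u [Ku ->]]] [d [v [Kv ->]]].
    exists (a * c + d), (a *: u + v); split; first exact: KL.
    by rewrite scalerDr scalerDl -scalerA addrACA.
  - move=> [c [u [Ku e]]]; apply: nex; exists c^-1.
    have c0 : c != 0.
      by apply/eqP => c0; apply: Kb; rewrite e c0 scale0r addr0.
    rewrite e scalerDr scalerA mulVf // scale1r opprD addrC subrK.
    by rewrite -scaleN1r; apply: (KZ); apply: (KZ).
  - by move=> _ q Qq; apply: KK'; exact: KQ.
have uniq y c d : K (y - c *: b0) -> K (y - d *: b0) -> c = d.
  move=> Kc Kd; apply/eqP; rewrite -subr_eq0; apply: contraT => cd.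
  case: Kb; rewrite -(scale1r b0) -(mulVf cd) -scalerA; apply: KZ.
  have -> : (c - d) *: b0 = -1 *: (y - c *: b0) + (y - d *: b0).
    by rewrite scaleN1r opprB addrA subrK scalerBl.
  exact: KL.
pose phi y := projT1 (cid (ex y)).
have phiP y : K (y - phi y *: b0) by exact: projT2 (cid (ex y)).
have lphi : scalar phi.
  move=> a u v; apply: (uniq (a *: u + v)); first exact: phiP.
  rewrite scalerDl opprD addrACA -scalerA -scalerBr.
  by apply: KL.
pose psi : {scalar B} := HB.pack phi (GRing.isLinear.Build k B k *%R phi lphi).
exists psi; split=> /=.
- by move=> q Qq; apply: (uniq q) => //; rewrite scale0r subr0; exact: KQ.
- by apply: (uniq b0) => //; rewrite scale1r subrr.
Qed.
End Functional.

Section Slice.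
Variables (k : fieldType) (A B : lmodType k) (P : A -> Prop).
Hypotheses (P0 : P 0) (PL : forall a u v, P u -> P v -> P (a *: u + v)).

Lemma slice_sub (t : tens A B) :
  (forall phi : {scalar B}, P (\tsum_(a, b <- t) phi b *: a)) ->
  exists s : seq (A * B), (forall p, p \in s -> P p.1)
    /\ t = \sum_(p <- s) p.1 ⊗ p.2.
Proof.
have hb (phi : {scalar B}) : bilin (fun (a : A) b => phi b *: a).
  split=> [b|a]; first by apply: lin_scalr.
  by apply: lin_scall.
have [n] := ubnP (size (repr t)).
have : t = \sum_(p <- repr t) p.1 ⊗ p.2 by exact: tens_repr.
move: (repr t) => r; elim: n r t => // n IH [|[a0 b0] r] t.
  by rewrite big_nil => -> _ _; exists [::]; rewrite big_nil.
rewrite big_cons /= => et; rewrite ltnS => szr hP.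
pose Q b := exists c : nat -> k, b = \sum_(i < size r) c i *: (nth 0 (unzip2 r) i).
have [[c eb]|nQ] := pselect (Q b0).
  have er : \sum_(p <- r) p.1 ⊗ p.2
      = \sum_(i < size r) (nth 0 (unzip1 r) i) ⊗ (nth 0 (unzip2 r) i).
    rewrite (big_nth (0, 0)) big_mkord; apply: eq_bigr => i _.
    by rewrite !(nth_map (0, 0)).
  pose s := [seq (nth 0 (unzip1 r) i + c i *: a0, nth 0 (unzip2 r) i) | i <- iota 0 (size r)].
  apply: (IH s) => //; last by rewrite size_map size_iota.
  rewrite et er eb (lin_sum (tenr a0)) big_map.
  have -> : iota 0 (size r) = index_iota 0 (size r) by rewrite /index_iota subn0.
  rewrite big_mkord -big_split /=.
  apply: eq_bigr => i _; rewrite addrC (linD (tenl _)); congr (_ + _).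
  by rewrite (linZ (tenl _)) (linZ (tenr _)).
have [||phi [phi0 phi1]] := @functional k B Q _ _ b0 nQ.
- by exists (fun=> 0); rewrite big1 // => i _; rewrite scale0r.
- move=> a _ _ [c ->] [d ->]; exists (fun i => a * c i + d i).
  rewrite scaler_sumr -big_split; apply: eq_bigr => i _ /=.
  by rewrite scalerDl scalerA.
have phir p : p \in r -> phi p.2 = 0.
  move=> pr; apply: phi0; exists (fun i => (i == index p r)%:R).
  have ip : (index p r < size r)%N by rewrite index_mem.
  rewrite (bigD1 (Ordinal ip)) //= eqxx scale1r big1 ?addr0.
    by rewrite (nth_map (0, 0)) // nth_index.
  by move=> i /negPf; rewrite -val_eqE /= => ->; rewrite scale0r.
have Pa0 : P a0.
  have := hP phi; rewrite et (linD (tsum_lin (hb phi))) (tsum_ten _ _ (hb phi)).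
  rewrite phi1 scale1r (lin_sum (tsum_lin (hb phi))) big_seq big1 ?addr0 // => p pr.
  by rewrite (tsum_ten _ _ (hb phi)) phir // scale0r.
have [||s [sP es]] := IH r (t - a0 ⊗ b0) _ szr.
- by rewrite et addrC addrA addNr add0r.
- move=> psi; rewrite -scaleN1r addrC (tsum_lin (hb psi)) (tsum_ten _ _ (hb psi)).
  by apply: PL => //; rewrite -[_ *: _]addr0; apply: PL.
exists ((a0, b0) :: s); split.
- by move=> p; rewrite inE => /orP[/eqP->//|/sP].
- by rewrite big_cons -es /= addrC subrK.
Qed.
End Slice.

Definition trilin (k : fieldType) (A B C U : lmodType k) (F : A -> B -> C -> U) :=
  [/\ forall b c, linear (fun a => F a b c),
      forall a c, linear (fun b => F a b c) & forall a b, linear (F a b)].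

Ltac lin2 := first [ lin1 | lazymatch goal with |- trilin _ => split; intros end].
Ltac lins := repeat lin2.

Lemma bilin_tri (k : fieldType) (A B C U : lmodType k) (F : A -> B -> C -> U) :
  trilin F -> bilin (fun a (u : tens B C) => tsum u (F a)).
Proof. by case=> F1 F2 F3; lins. Qed.

Record hopfAlg (k : fieldType) := HopfAlg {
  hopf_car :> algType k;
  Delta : {linear hopf_car -> tens hopf_car hopf_car};
  counit : {scalar hopf_car};
  antipode : {linear hopf_car -> hopf_car};
  DeltaA : forall h, \tsum_(a, b <- Delta h) (a ⊗ Delta b)
    = \tsum_(a, b <- Delta h) \tsum_(c, d <- Delta a) (c ⊗ (d ⊗ b));
  counitl : forall h, \tsum_(a, b <- Delta h) counit a *: b = h;
  counitr : forall h, \tsum_(a, b <- Delta h) counit b *: a = h;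
  Delta1 : Delta 1 = 1 ⊗ 1;
  DeltaM : forall g h, Delta (g * h)
    = \tsum_(a, b <- Delta g) \tsum_(c, d <- Delta h) (a * c) ⊗ (b * d);
  counit1 : counit 1 = 1;
  counitM : forall g h, counit (g * h) = counit g * counit h;
  antipodel : forall h, \tsum_(a, b <- Delta h) antipode a * b = counit h *: 1;
  antipoder : forall h, \tsum_(a, b <- Delta h) a * antipode b = counit h *: 1
}.
Arguments Delta {k h} : rename.
Arguments counit {k h} : rename.
Arguments antipode {k h} : rename.

Record hopfAlgInv (k : fieldType) := HopfAlgInv {
  hopfInv_car :> hopfAlg k;
  antipodeV : {linear hopfInv_car -> hopfInv_car};
  antipodeK : cancel antipode antipodeV;
  antipodeVK : cancel antipodeV antipode
}.
Arguments antipodeV {k h} : rename.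

Section HopfTheory.
Variables (k : fieldType) (H : hopfAlg k).
Implicit Types (U : lmodType k) (a b c d g h : H).
Notation S := (@antipode k H).

Lemma Delta_tri U (F : H -> H -> H -> U) h : trilin F ->
  \tsum_(a, b <- Delta h) \tsum_(c, d <- Delta b) F a c d
  = \tsum_(a, b <- Delta h) \tsum_(c, d <- Delta a) F c d b.
Proof.
move=> hF; have hb := bilin_tri hF.
have := congr1 (fun t => \tsum_(a, u <- t) tsum u (F a)) (DeltaA h).
rewrite !(tsumC _ _ hb) => e.
transitivity (\tsum_(a, b <- Delta h) \tsum_(a0, u <- (a ⊗ Delta b)) tsum u (F a0)).
  by apply: eq_tsum => a b; rewrite (tsum_ten _ _ hb).
rewrite e; apply: eq_tsum => a b; rewrite (tsumC _ _ hb).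
apply: eq_tsum => c d; rewrite (tsum_ten _ _ hb) tsum_ten //.
by case: hF => *; split.
Qed.

Lemma antipode1 : S 1 = 1.
Proof.
have := antipodel (1 : H); rewrite Delta1 tsum_ten; last by lins.
by rewrite mulr1 counit1 scale1r.
Qed.

Lemma antipode_eps h : counit (S h) = counit h :> k.
Proof.
have e1 : \tsum_(a, b <- Delta h) counit b *: S a = S h.
  rewrite -[in RHS](counitr h) (tsum_fun _ _ (f := S)); last exact: linearP.
  by apply: eq_tsum => a b; rewrite linearZ.
have := congr1 counit (antipodel h); rewrite linearZ /= counit1 mulr1 => <-.
rewrite -e1 /tsum !linear_sum; apply: eq_bigr => p _.
by rewrite linearZ /= counitM mulrC.
Qed.

Lemma antipodeM g h : S (g * h) = S h * S g.
Proof.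
pose K a b := \tsum_(a2, a3 <- Delta a) \tsum_(b2, b3 <- Delta b)
  (a2 * b2) * (S b3 * S a3).
have KE a b : K a b = (counit a * counit b) *: 1.
  rewrite /K; transitivity (\tsum_(a2, a3 <- Delta a) counit b *: (a2 * S a3)).
    apply: eq_tsum => a2 a3.
    transitivity (a2 * (\tsum_(b2, b3 <- Delta b) b2 * S b3) * S a3).
      rewrite (tsum_fun _ _ (f := fun x => a2 * x * S a3)); last by lins.
      by apply: eq_tsum => b2 b3; rewrite !mulrA.
    by rewrite antipoder -scalerAr mulr1 -scalerAl.
  rewrite -(tsum_fun _ _ (f := fun x => counit b *: x)); last by lins.
  by rewrite antipoder scalerA mulrC.
pose K' a b := \tsum_(a1, a2 <- Delta a) \tsum_(b1, b2 <- Delta b)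
  S (a1 * b1) * (a2 * b2).
have K'E a b : K' a b = (counit a * counit b) *: 1.
  have := antipodel (a * b); rewrite DeltaM counitM => <-.
  rewrite tsumC; last by lins.
  apply: eq_tsum => a1 a2; rewrite tsumC; last by lins.
  by apply: eq_tsum => b1 b2; rewrite tsum_ten //; lins.
transitivity (\tsum_(a1, a' <- Delta g) \tsum_(b1, b' <- Delta h)
    S (a1 * b1) * K a' b').
  rewrite -[in LHS](counitr g) -[in LHS](counitr h).
  rewrite (tsum_fun _ _ (f := fun x => S (x * _))); last by lins.
  apply: eq_tsum => a1 a'.
  rewrite (tsum_fun _ _ (f := fun x => S (_ * x))); last by lins.
  apply: eq_tsum => b1 b'; rewrite KE -scalerAl -!scalerAr mulr1 scalerA.
  by rewrite linearZ.
transitivity (\tsum_(a', a3 <- Delta g) \tsum_(b', b3 <- Delta h)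
    K' a' b' * (S b3 * S a3)); last first.
  rewrite -[in RHS](counitl g) -[in RHS](counitl h).
  rewrite (tsum_fun _ _ (f := fun x => _ * S x)); last by lins.
  apply: eq_tsum => a' a3.
  rewrite (tsum_fun _ _ (f := fun x => S x * _)); last by lins.
  apply: eq_tsum => b' b3; rewrite K'E !linearZ_LR /= -!scalerAl mul1r -scalerAr.
  by rewrite !scalerA mulrC.
pose F a1 a2 a3 b1 b2 b3 := S (a1 * b1) * ((a2 * b2) * (S b3 * S a3)).
transitivity (\tsum_(a1, a' <- Delta g) \tsum_(a2, a3 <- Delta a')
   \tsum_(b1, b' <- Delta h) \tsum_(b2, b3 <- Delta b') F a1 a2 a3 b1 b2 b3).
  apply: eq_tsum => a1 a'; rewrite tsum_swap; apply: eq_tsum => b1 b'.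
  rewrite (tsum_fun _ _ (f := fun x => S _ * x)); last by lins.
  apply: eq_tsum => a2 a3.
  by rewrite (tsum_fun _ _ (f := fun x => S _ * x)); last by lins.
rewrite Delta_tri; last by rewrite /F; lins.
apply: eq_tsum => a' a3.
transitivity (\tsum_(a1, a2 <- Delta a') \tsum_(b', b3 <- Delta h)
  \tsum_(b1, b2 <- Delta b') F a1 a2 a3 b1 b2 b3).
  by apply: eq_tsum => a1 a2; rewrite Delta_tri //; rewrite /F; lins.
rewrite tsum_swap; apply: eq_tsum => b' b3.
rewrite (tsum_fun _ _ (f := fun x => x * (S _ * S _))); last by lins.
apply: eq_tsum => a1 a2.
rewrite (tsum_fun _ _ (f := fun x => x * (S _ * S _))); last by lins.
by apply: eq_tsum => b1 b2; rewrite /F !mulrA.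
Qed.

Definition mul2 (x y : tens H H) : tens H H :=
  \tsum_(a, b <- x) \tsum_(c, d <- y) (a * c) ⊗ (b * d).
Lemma mul2_bilin : bilin mul2.
Proof. by rewrite /mul2; lins. Qed.
Lemma mul2E a b c d : mul2 (a ⊗ b) (c ⊗ d) = (a * c) ⊗ (b * d).
Proof. by rewrite /mul2 tsum_ten ?tsum_ten //; lins. Qed.
Lemma mul2A x y z : mul2 x (mul2 y z) = mul2 (mul2 x y) z.
Proof.
have [l r] := mul2_bilin.
move: x; apply: tens_ext => [||a b].
- by move=> c u v; rewrite l.
- by move=> c u v; rewrite l l.
move: y; apply: tens_ext => [||a' b'].
- by move=> c u v; rewrite l r.
- by move=> c u v; rewrite r l.
move: z; apply: tens_ext => [||a'' b''].
- by move=> c u v; rewrite r r.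
- by move=> c u v; rewrite r.
by rewrite !mul2E !mulrA.
Qed.
Lemma mul21 x : mul2 x (1 ⊗ 1) = x.
Proof.
have [l r] := mul2_bilin.
by move: x; apply: tens_ext => // a b; rewrite mul2E !mulr1.
Qed.
Lemma mul12 x : mul2 (1 ⊗ 1) x = x.
Proof.
have [l r] := mul2_bilin.
by move: x; apply: tens_ext => // a b; rewrite mul2E !mul1r.
Qed.

Lemma Delta_antipode h : Delta (S h) = \tsum_(a, b <- Delta h) (S b ⊗ S a).
Proof.
have [l r] := mul2_bilin.
pose Y h := \tsum_(a, b <- Delta h) (S b ⊗ S a).
have Ylin : linear Y by rewrite /Y; lins.
have KE x : \tsum_(a, b <- Delta x) mul2 (Delta a) (Y b) = counit x *: (1 ⊗ 1).
  pose F a1 a2 a3 a4 := (a1 * S a4) ⊗ (a2 * S a3).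
  transitivity (\tsum_(a, b <- Delta x) \tsum_(a1, a2 <- Delta a)
     \tsum_(a3, a4 <- Delta b) F a1 a2 a3 a4).
    apply: eq_tsum => a b; rewrite {1}/mul2; apply: eq_tsum => a1 a2.
    rewrite /Y tsumC; last by lins.
    by apply: eq_tsum => a3 a4; rewrite tsum_ten //; lins.
  rewrite -(Delta_tri (F := fun a1 a2 b => \tsum_(a3, a4 <- Delta b) F a1 a2 a3 a4));
    last by rewrite /F; lins.
  transitivity (\tsum_(a1, b <- Delta x) \tsum_(c, a4 <- Delta b)
      \tsum_(a2, a3 <- Delta c) F a1 a2 a3 a4).
    apply: eq_tsum => a1 b.
    by rewrite (Delta_tri (F := fun a2 a3 a4 => F a1 a2 a3 a4)) // /F; lins.
  transitivity (\tsum_(a1, b <- Delta x) \tsum_(c, a4 <- Delta b)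
      (a1 * S (counit c *: a4)) ⊗ (1 : H)).
    apply: eq_tsum => a1 b; apply: eq_tsum => c a4; rewrite /F.
    rewrite -(tsum_fun _ _ (f := fun z => (a1 * S a4) ⊗ z)); last by lins.
    rewrite antipoder (linZ (tenr _)) -(linZ (tenl _)).
    by rewrite linearZ_LR /= scalerAr.
  transitivity (\tsum_(a1, b <- Delta x) (a1 * S b) ⊗ (1 : H)).
    apply: eq_tsum => a1 b.
    rewrite -(tsum_fun _ _ (f := fun z => (a1 * S z) ⊗ (1 : H))); last by lins.
    by rewrite counitl.
  rewrite -(tsum_fun _ _ (f := fun z => z ⊗ (1 : H))); last by lins.
  by rewrite antipoder (linZ (tenl _)).
have K'E x : \tsum_(a, b <- Delta x) mul2 (Delta (S a)) (Delta b) = counit x *: (1 ⊗ 1).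
  transitivity (\tsum_(a, b <- Delta x) Delta (S a * b)).
    by apply: eq_tsum => a b; rewrite DeltaM.
  rewrite -(tsum_fun _ _ (f := fun z => Delta z)); last by lins.
  by rewrite antipodel linearZ_LR /= Delta1.
rewrite -/(Y h).
transitivity (\tsum_(a, b <- Delta h) mul2 (Delta (S a))
   (\tsum_(c, d <- Delta b) mul2 (Delta c) (Y d))).
  rewrite -[in LHS](counitr h) (tsum_fun _ _ (f := fun z => Delta (S z))); last by lins.
  apply: eq_tsum => a b; rewrite KE (linZ (r _)) mul21.
  by rewrite !linearZ_LR.
transitivity (\tsum_(b, d <- Delta h) mul2
   (\tsum_(a, c <- Delta b) mul2 (Delta (S a)) (Delta c)) (Y d)); last first.
  rewrite -[in RHS](counitl h) (tsum_fun _ _ Ylin).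
  apply: eq_tsum => b d; rewrite K'E (linZ (l _)) mul12.
  by rewrite (linZ Ylin).
transitivity (\tsum_(a, b <- Delta h) \tsum_(c, d <- Delta b)
    mul2 (Delta (S a)) (mul2 (Delta c) (Y d))).
  by apply: eq_tsum => a b; rewrite (tsum_fun _ _ (r _)).
rewrite Delta_tri.
  apply: eq_tsum => b d; rewrite (tsum_fun _ _ (l (Y d))).
  by apply: eq_tsum => a c; rewrite mul2A.
split=> [b c|a c|a b] e u v.
- by rewrite !linearP l.
- by rewrite linearP l r.
- by rewrite Ylin !r.
Qed.
End HopfTheory.

Section HopfInvTheory.
Variables (k : fieldType) (H : hopfAlgInv k).
Implicit Types (U : lmodType k) (a b c d g h : H).
Notation S := (@antipode k H).
Notation V := (@antipodeV k H).

Lemma antipodeVM g h : V (g * h) = V h * V g.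
Proof. by apply: (can_inj (@antipodeK k H)); rewrite antipodeM !antipodeVK. Qed.
Lemma antipodeV1 : V 1 = 1.
Proof. by apply: (can_inj (@antipodeK k H)); rewrite antipode1 antipodeVK. Qed.
Lemma antipodeV_eps h : counit (V h) = counit h :> k.
Proof. by rewrite -[in RHS](antipodeVK h) antipode_eps. Qed.
Lemma antipodeVl h : \tsum_(a, b <- Delta h) V b * a = counit h *: 1.
Proof.
apply: (can_inj (@antipodeK k H)); rewrite linearZ_LR /= antipode1 -antipodel.
rewrite (tsum_fun _ _ (f := S)); last by lins.
by apply: eq_tsum => a b; rewrite antipodeM antipodeVK.
Qed.
Lemma antipodeVr h : \tsum_(a, b <- Delta h) b * V a = counit h *: 1.
Proof.
apply: (can_inj (@antipodeK k H)); rewrite linearZ_LR /= antipode1 -antipoder.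
rewrite (tsum_fun _ _ (f := S)); last by lins.
by apply: eq_tsum => a b; rewrite antipodeM antipodeVK.
Qed.
Lemma Delta_antipodeV h : Delta (V h) = \tsum_(a, b <- Delta h) (V b ⊗ V a).
Proof.
have {2}<- := antipodeVK h; rewrite Delta_antipode tsumC; last by lins.
rewrite [LHS]tens_repr; apply: eq_tsum => a b.
by rewrite tsum_ten ?antipodeK //; lins.
Qed.
End HopfInvTheory.

Record comod (k : fieldType) (H : hopfAlg k) := Comod {
  comod_car :> lmodType k;
  coact : {linear comod_car -> tens comod_car H};
  coactA : forall m, \tsum_(m0, m1 <- coact m) (m0 ⊗ Delta m1)
    = \tsum_(m0, m1 <- coact m) \tsum_(n0, n1 <- coact m0) (n0 ⊗ (n1 ⊗ m1));
  coact_counit : forall m, \tsum_(m0, m1 <- coact m) counit m1 *: m0 = m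
}.
Arguments coact {k H c} : rename.

Record comodHom (k : fieldType) (H : hopfAlg k) (M N : comod H) := ComodHom {
  comodHom_lin :> {linear M -> N};
  comodHomP : forall m, coact (comodHom_lin m)
    = \tsum_(m0, m1 <- coact m) (comodHom_lin m0 ⊗ m1)
}.

Section Comodules.
Variables (k : fieldType) (H : hopfAlg k).
Implicit Types (L M N T V W : comod H) (U : lmodType k).

Lemma coact_tri M U (F : M -> H -> H -> U) m : trilin F ->
  \tsum_(m0, m1 <- coact m) \tsum_(c, d <- Delta m1) F m0 c d
  = \tsum_(m0, m1 <- coact m) \tsum_(n0, n1 <- coact m0) F n0 n1 m1.
Proof.
move=> hF; have hb := bilin_tri hF.
have := congr1 (fun t => \tsum_(a, u <- t) tsum u (F a)) (coactA m).
rewrite !(tsumC _ _ hb) => e.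
transitivity (\tsum_(a, b <- coact m) \tsum_(a0, u <- (a ⊗ Delta b)) tsum u (F a0)).
  by apply: eq_tsum => a b; rewrite (tsum_ten _ _ hb).
rewrite e; apply: eq_tsum => a b; rewrite (tsumC _ _ hb).
apply: eq_tsum => c d; rewrite (tsum_ten _ _ hb) tsum_ten //.
by case: hF => *; split.
Qed.

Lemma comodHom_eq M N (f g : comodHom M N) : f =1 g -> f = g.
Proof.
case: f g => [f hf] [g hg] /= /linear_eq e; subst g.
by rewrite (Prop_irrelevance hf hg).
Qed.

Fact comod_id_subproof M (m : M) :
  coact (idfun m) = \tsum_(m0, m1 <- coact m) (idfun m0 ⊗ m1).
Proof. exact: tens_repr. Qed.
Definition comod_id M : comodHom M M :=
  @ComodHom k H M M (@idfun M : {linear M -> M}) (@comod_id_subproof M).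

Fact comod_comp_subproof L M N (g : comodHom M N) (f : comodHom L M) x :
  coact ((g \o f) x) = \tsum_(m0, m1 <- coact x) ((g \o f) m0 ⊗ m1).
Proof.
rewrite /= comodHomP comodHomP tsumC; last by lins.
by apply: eq_tsum => a b; rewrite tsum_ten //; lins.
Qed.
Definition comod_comp L M N (g : comodHom M N) (f : comodHom L M) :
  comodHom L N := ComodHom (@comod_comp_subproof L M N g f).

Definition is_comod_iso M N (f : comodHom M N) : Prop :=
  exists g : comodHom N M, comod_comp g f = comod_id M /\ comod_comp f g = comod_id N.

Fact unit_coact_subproof : linear (fun c : k^o => c ⊗ (1 : H)).
Proof. by lins. Qed.
Fact unit_coactA (c : k^o) :
  \tsum_(m0, m1 <- mklin unit_coact_subproof c) (m0 ⊗ Delta m1)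
  = \tsum_(m0, m1 <- mklin unit_coact_subproof c)
      \tsum_(n0, n1 <- mklin unit_coact_subproof m0) (n0 ⊗ (n1 ⊗ m1)).
Proof.
rewrite /= !tsum_ten ?Delta1; try by lins.
Qed.
Fact unit_coact_counit (c : k^o) :
  \tsum_(m0, m1 <- mklin unit_coact_subproof c) counit m1 *: m0 = c.
Proof. by rewrite /= tsum_ten ?counit1 ?scale1r //; lins. Qed.
Definition unit_comod : comod H := Comod unit_coactA unit_coact_counit.

Section TensorComod.
Variables M N : comod H.
Definition tens_coact (x : tens M N) : tens (tens M N) H :=
  \tsum_(m, n <- x) \tsum_(m0, m1 <- coact m) \tsum_(n0, n1 <- coact n)
    (m0 ⊗ n0) ⊗ (m1 * n1).
Fact tens_coact_lin : linear tens_coact.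
Proof. by rewrite /tens_coact; lins. Qed.
Lemma tens_coactE m n : tens_coact (m ⊗ n) =
  \tsum_(m0, m1 <- coact m) \tsum_(n0, n1 <- coact n) (m0 ⊗ n0) ⊗ (m1 * n1).
Proof. by rewrite /tens_coact tsum_ten //; lins. Qed.
Lemma tens_coact_tsum U (F : tens M N -> H -> U) m n : bilin F ->
  tsum (tens_coact (m ⊗ n)) F =
  \tsum_(m0, m1 <- coact m) \tsum_(n0, n1 <- coact n) F (m0 ⊗ n0) (m1 * n1).
Proof.
move=> hF; rewrite tens_coactE (tsumC _ _ hF); apply: eq_tsum => m0 m1.
by rewrite (tsumC _ _ hF); apply: eq_tsum => n0 n1; rewrite (tsum_ten _ _ hF).
Qed.
Fact tens_coactA (x : tens M N) :
  \tsum_(m0, m1 <- mklin tens_coact_lin x) (m0 ⊗ Delta m1)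
  = \tsum_(m0, m1 <- mklin tens_coact_lin x)
      \tsum_(n0, n1 <- mklin tens_coact_lin m0) (n0 ⊗ (n1 ⊗ m1)).
Proof.
move: x; apply: tens_ext => [||m n] /=.
- by lins; exact: tens_coact_lin.
- by lins; exact: tens_coact_lin.
rewrite !tens_coact_tsum; try by lins; try exact: tens_coact_lin.
pose F m0 m1 m2 n0 n1 n2 : tens (tens M N) (tens H H) :=
  (m0 ⊗ n0) ⊗ ((m1 * n1) ⊗ (m2 * n2)).
transitivity (\tsum_(m0, m1 <- coact m) \tsum_(c, d <- Delta m1)
  \tsum_(n0, n1 <- coact n) \tsum_(c', d' <- Delta n1) F m0 c d n0 c' d').
  apply: eq_tsum => m0 m1; rewrite tsum_swap; apply: eq_tsum => n0 n1.
  rewrite DeltaM (tsum_fun _ _ (tenr _)); apply: eq_tsum => c d.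
  by rewrite (tsum_fun _ _ (tenr _)).
rewrite coact_tri; last by rewrite /F; lins.
apply: eq_tsum => m0 m1.
transitivity (\tsum_(n0, n1 <- coact m0) \tsum_(n2, n3 <- coact n)
  \tsum_(a, b <- coact n2) F n0 n1 m1 a b n3).
  apply: eq_tsum => a b; rewrite -(coact_tri (F := fun x y z => F a b m1 x y z)) //.
  by rewrite /F; lins.
rewrite tsum_swap; apply: eq_tsum => n0 n1.
by rewrite tens_coact_tsum //; lins.
Qed.
Fact tens_coact_counit (x : tens M N) :
  \tsum_(m0, m1 <- mklin tens_coact_lin x) counit m1 *: m0 = x.
Proof.
move: x; apply: tens_ext => [||m n] /=.
- by lins; exact: tens_coact_lin.
- by lins.
rewrite tens_coact_tsum; last by lins.
rewrite -[in RHS](coact_counit m) (tsum_fun _ _ (tenl _)).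
apply: eq_tsum => m0 m1.
rewrite -[in RHS](coact_counit n) (tsum_fun _ _ (tenr _)).
apply: eq_tsum => n0 n1.
by rewrite (linZ (tenl _)) (linZ (tenr _)) scalerA counitM.
Qed.
Definition tens_comod : comod H := Comod tens_coactA tens_coact_counit.
End TensorComod.
End Comodules.

Variant side := Left | Right.

Section Twist.
Variables (k : fieldType) (H : hopfAlgInv k).
Implicit Types (d : side) (x y z h : H) (U : lmodType k).

Definition twist d x y : H :=
  match d with Left => x * antipode y | Right => antipodeV y * x end.
Definition smul d x y : H := match d with Left => x * y | Right => y * x end.

Lemma twist_bilin d : bilin (twist d).
Proof. by rewrite /twist; case: d; lins. Qed.
Lemma smul_bilin d : bilin (smul d).
Proof. by rewrite /smul; case: d; lins. Qed.
Lemma twist_counit d x y : counit (twist d x y) = counit x * counit y :> k.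
Proof.
by case: d; rewrite /= counitM ?antipode_eps ?antipodeV_eps // mulrC.
Qed.
Lemma Delta_twist d x y : Delta (twist d x y) =
  \tsum_(a, b <- Delta x) \tsum_(c, e <- Delta y) (twist d a e ⊗ twist d b c).
Proof.
case: d; rewrite /= DeltaM ?Delta_antipode ?Delta_antipodeV.
  apply: eq_tsum => a b; rewrite tsumC; last by lins.
  by apply: eq_tsum => c e; rewrite tsum_ten //; lins.
rewrite tsum_swap; apply: eq_tsum => a b; rewrite tsumC; last by lins.
by apply: eq_tsum => c e; rewrite tsum_ten //; lins.
Qed.
Lemma twist_smul d z x y : twist d z (smul d x y) = twist d (twist d z y) x.
Proof. by case: d; rewrite /= ?antipodeM ?antipodeVM !mulrA. Qed.
Lemma smul_twistl d z x :
  \tsum_(a, b <- Delta x) smul d (twist d z a) b = counit x *: z.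
Proof.
case: d => /=.
- rewrite -[in RHS](mulr1 z) scalerAr -antipodel (tsum_fun _ _ (f := *%R z)); last by lins.
  by apply: eq_tsum => a b; rewrite mulrA.
- rewrite -[in RHS](mul1r z) scalerAl -antipodeVr.
  rewrite (tsum_fun _ _ (f := fun u => u * z)); last by lins.
  by apply: eq_tsum => a b; rewrite mulrA.
Qed.
Lemma twist_smull d z x :
  \tsum_(a, b <- Delta x) twist d (smul d z a) b = counit x *: z.
Proof.
case: d => /=.
- rewrite -[in RHS](mulr1 z) scalerAr -antipoder (tsum_fun _ _ (f := *%R z)); last by lins.
  by apply: eq_tsum => a b; rewrite mulrA.
- rewrite -[in RHS](mul1r z) scalerAl -antipodeVl.
  rewrite (tsum_fun _ _ (f := fun u => u * z)); last by lins.
  by apply: eq_tsum => a b; rewrite mulrA.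
Qed.
Lemma twist1 d z : twist d z 1 = z.
Proof. by case: d; rewrite /= ?antipode1 ?antipodeV1 ?mulr1 ?mul1r. Qed.
End Twist.

Ltac lin3 := first [ lin2 | lazymatch goal with |- linear _ => first
   [ apply: (lin_bill _ (@twist_bilin _ _ _)) | apply: (lin_bilr _ (@twist_bilin _ _ _))
   | apply: (lin_bill _ (@smul_bilin _ _ _)) | apply: (lin_bilr _ (@smul_bilin _ _ _)) ] end ].
Ltac lint := repeat lin3.

Section InternalHom.
Variables (k : fieldType) (H : hopfAlgInv k).
Implicit Types (L M N T V W X Y : comod H) (U : lmodType k) (d : side).

(* The index [d] treats Hom^l and Hom^r together:
   [Left]:  f(w_0)_0 ⊗ f(w_0)_1 S(w_1), [Right]: f(w_0)_0 ⊗ S^{-1}(w_1) f(w_0)_1. *)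
Definition rho d W V (f : W -> V) (w : W) : tens V H :=
  \tsum_(w0, w1 <- coact w) \tsum_(v0, v1 <- coact (f w0)) v0 ⊗ twist d v1 w1.

(* rho d f, an element of Hom(W, V ⊗ H), lies in (the image of) Hom(W, V) ⊗ H. *)
Definition rational d W V (f : {linear W -> V}) : Prop :=
  exists t : tens {linear W -> V} H,
    forall w, rho d f w = \tsum_(g, h <- t) g w ⊗ h.

Definition ihom_pred d W V : {pred {linear W -> V}} :=
  fun f => `[< rational d f >].

Lemma rho_lin d W V (f : {linear W -> V}) : linear (rho d f).
Proof. by rewrite /rho; lint. Qed.

Lemma rho_linf d W V w : linear (fun f : {linear W -> V} => rho d f w).
Proof. by rewrite /rho; lint. Qed.

Lemma tsum_rho U d W V (f : W -> V) w (F : V -> H -> U) : bilin F ->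
  tsum (rho d f w) F =
  \tsum_(w0, w1 <- coact w) \tsum_(v0, v1 <- coact (f w0)) F v0 (twist d v1 w1).
Proof.
move=> hF; rewrite /rho (tsumC _ _ hF); apply: eq_tsum => a b.
by rewrite (tsumC _ _ hF); apply: eq_tsum => x y; rewrite (tsum_ten _ _ hF).
Qed.

Fact ihom_closed d W V : GRing.subsemimod_closed (@ihom_pred d W V).
Proof.
split; first split.
- apply/asboolP; exists 0 => w.
  rewrite (lin0 (rho_linf d w)) (lin0 (tsum_lin _)) //; lint.
- move=> f g /asboolP[t ht] /asboolP[u hu]; apply/asboolP; exists (t + u) => w.
  rewrite (linD (rho_linf d w)) ht hu (linD (tsum_lin _)) //; lint.
- move=> c f /asboolP[t ht]; apply/asboolP; exists (c *: t) => w.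
  rewrite (linZ (rho_linf d w)) ht (linZ (tsum_lin _)) //; lint.
Qed.
HB.instance Definition _ d W V :=
  GRing.isSubmodClosed.Build k {linear W -> V} (@ihom_pred d W V) (@ihom_closed d W V).

Record ihom d W V := IHom {
  ihom_lin :> {linear W -> V};
  ihomP : ihom_lin \in @ihom_pred d W V
}.
HB.instance Definition _ d W V := [isSub for @ihom_lin d W V].
HB.instance Definition _ d W V := [Choice of ihom d W V by <:].
HB.instance Definition _ d W V := [SubChoice_isSubLmodule of ihom d W V by <:].

End InternalHom.

Lemma ihom_lin_linear (k : fieldType) (H : hopfAlgInv k) d (W V : comod H) :
  linear (@ihom_lin k H d W V).
Proof. by []. Qed.

Ltac lin4 := first [ lin3 | lazymatch goal with |- linear _ =>
  apply: (lin_compH (@ihom_lin_linear _ _ _ _ _)) end ].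
Ltac linh := repeat lin4.

Section IHomComod.
Variables (k : fieldType) (H : hopfAlgInv k).
Implicit Types (L M N T V W X Y : comod H) (U : lmodType k) (d : side).

Lemma ihom_eq d W V (f g : ihom d W V) : f =1 g -> f = g.
Proof. by move=> e; apply: val_inj; apply: linear_eq. Qed.

Lemma ihom_sep d W V (B : lmodType k) (t u : tens (ihom d W V) B) :
  (forall w, \tsum_(g, b <- t) (g w ⊗ b) = \tsum_(g, b <- u) (g w ⊗ b)) -> t = u.
Proof.
move=> e; apply/eqP; rewrite -subr_eq0; apply/eqP; set z := t - u.
have {e} e w : \tsum_(g, b <- z) (g w ⊗ b) = 0.
  rewrite /z -scaleN1r addrC (tsum_lin (F := fun (g : ihom d W V) b => g w ⊗ b)).
    by rewrite e scaleN1r addNr.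
  by linh.
have [||phi|s [s0 ->]] := @slice_sub k _ B (fun g : ihom d W V => g = 0) _ _ z.
- by [].
- by move=> a g h -> ->; rewrite scaler0 addr0.
- apply: ihom_eq => w.
  rewrite (tsum_fun _ _ (f := fun g : ihom d W V => g w)); last by linh.
  have := congr1 (fun x => \tsum_(v, b <- x) phi b *: v) (e w).
  rewrite tsumC; last by lins.
  rewrite [X in _ = X -> _](lin0 (tsum_lin _)); last by lins.
  move=> e0; transitivity (0 : V); last by [].
  rewrite -[RHS]e0; apply: eq_tsum => g b.
  by rewrite tsum_ten //; lins.
- rewrite big_seq big1 // => p /s0 ->.
  by rewrite (lin0 (tenl _)).
Qed.

Lemma rho_coassoc d W V (A : lmodType k) (e : {linear A -> {linear W -> V}})
  (t : tens A H) (f : {linear W -> V}) :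
  (forall w, rho d f w = \tsum_(g, h <- t) e g w ⊗ h) ->
  forall w, \tsum_(g, h <- t) \tsum_(v, x <- rho d (e g) w) (v ⊗ (x ⊗ h))
   = \tsum_(v, h <- rho d f w) (v ⊗ Delta h).
Proof.
move=> ht w.
transitivity (\tsum_(w0, w1 <- coact w) \tsum_(g, h <- t)
   \tsum_(v0, v1 <- coact (e g w0)) (v0 ⊗ (twist d v1 w1 ⊗ h))).
  rewrite tsum_swap; apply: eq_tsum => g h.
  by rewrite tsum_rho //; lint.
transitivity (\tsum_(w0, w1 <- coact w) \tsum_(v, h <- rho d f w0)
   \tsum_(v0, v1 <- coact v) (v0 ⊗ (twist d v1 w1 ⊗ h))).
  apply: eq_tsum => w0 w1; rewrite ht tsumC; last by lint.
  by apply: eq_tsum => g h; rewrite tsum_ten //; lint.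
pose F b c v0 v1 v2 : tens V (tens H H) :=
  v0 ⊗ (twist d v1 c ⊗ twist d v2 b).
transitivity (\tsum_(w0, w1 <- coact w) \tsum_(a, b <- coact w0)
  \tsum_(v, y <- coact (f a)) \tsum_(v0, v1 <- coact v) F b w1 v0 v1 y).
  by apply: eq_tsum => w0 w1; rewrite tsum_rho //; lint.
rewrite -(coact_tri (F := fun a b c => \tsum_(v, y <- coact (f a))
    \tsum_(v0, v1 <- coact v) F b c v0 v1 y)); last by rewrite /F; lint.
rewrite tsum_rho; last by lint.
apply: eq_tsum => w0 w1.
transitivity (\tsum_(c, e0 <- Delta w1) \tsum_(v0, v1 <- coact (f w0))
  \tsum_(a, b <- Delta v1) F c e0 v0 a b).
  apply: eq_tsum => c e0.
  by rewrite -(coact_tri (F := fun x y z => F c e0 x y z)) // /F; lint.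
rewrite tsum_swap; apply: eq_tsum => v0 v1.
rewrite Delta_twist tsum_swap (tsum_fun _ _ (tenr _)).
by apply: eq_tsum => a b; rewrite (tsum_fun _ _ (tenr _)).
Qed.

Lemma ihom_coact_ex d W V (f : ihom d W V) :
  exists u : tens (ihom d W V) H, forall w, rho d f w = \tsum_(g, h <- u) g w ⊗ h.
Proof.
case: f => f /[dup] /asboolP [t ht] /= fP.
have [|||s [sP es]] := @slice_sub k _ H (@rational k H d W V) _ _ t.
- by have [[/asboolP]] := @ihom_closed k H d W V.
- have [[_ hD] hZ] := @ihom_closed k H d W V.
  move=> a u v /asboolP ru /asboolP rv; apply/asboolP; apply: hD => //.
  exact: hZ.
- move=> phi.
  pose psi (x : H) := \tsum_(a, b <- Delta x) phi b *: a.
  have lpsi : linear psi by rewrite /psi; lint.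
  exists (\tsum_(g, h <- t) g ⊗ psi h) => w.
  rewrite (tsum_fun _ _ (rho_linf d w)).
  have := congr1 (fun x => \tsum_(v, y <- x) v ⊗ (\tsum_(a, b <- y) phi b *: a))
    (rho_coassoc (e := idfun) ht w).
  have hb : bilin (fun (v : V) (y : tens H H) => v ⊗ (\tsum_(a, b <- y) phi b *: a)).
    by lint.
  rewrite !(tsumC _ _ hb) => e.
  transitivity (\tsum_(a, b <- t) \tsum_(v, x <- rho d a w) phi b *: (v ⊗ x)).
    apply: eq_tsum => a b.
    by rewrite (linZ (rho_linf d w)) [in LHS](tens_repr (rho d a w)) /tsum scaler_sumr.
  transitivity (\tsum_(v, h <- rho d f w) (v ⊗ psi h)).
    rewrite -[LHS]/(tsum _ _).
    transitivity (\tsum_(v, h <- rho d f w)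
       \tsum_(v0, y <- (v ⊗ Delta h)) (v0 ⊗ (\tsum_(a, b <- y) phi b *: a))); last first.
      by apply: eq_tsum => v h; rewrite tsum_ten.
    rewrite -e; apply: eq_tsum => g h; rewrite (tsumC _ _ hb).
    apply: eq_tsum => v x; rewrite tsum_ten // tsum_ten; last by lint.
    by rewrite (linZ (tenr _)).
  rewrite ht tsumC; last by linh.
  rewrite tsumC; last by linh.
  apply: eq_tsum => g h; rewrite tsum_ten; last by linh.
  by rewrite tsum_ten //; linh.
pose val_of (g : {linear W -> V}) : ihom d W V := insubd 0 g.
exists (\sum_(p <- s) val_of p.1 ⊗ p.2) => w.
rewrite ht es !(lin_sum (tsum_lin _)); try by linh.
rewrite !big_seq; apply: eq_bigr => p ps.
rewrite !tsum_ten; try by linh.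
by rewrite /val_of insubdK //; apply/asboolP; exact: sP.
Qed.

(* By [ihom_sep] the element chosen here is the only one satisfying
   [ihom_coactE]: it is rho d f, which thus lies in Hom^d(W, V) ⊗ H. *)
Definition ihom_coact d W V (f : ihom d W V) : tens (ihom d W V) H :=
  projT1 (cid (ihom_coact_ex f)).
Lemma ihom_coactE d W V (f : ihom d W V) w :
  \tsum_(g, h <- ihom_coact f) (g w ⊗ h) = rho d f w.
Proof. by rewrite (projT2 (cid (ihom_coact_ex f))). Qed.

Fact ihom_coact_lin d W V : linear (@ihom_coact d W V).
Proof.
move=> a f g; apply: ihom_sep => w.
rewrite (tsum_lin (F := fun (g : ihom d W V) h => g w ⊗ h)); last by linh.
by rewrite !ihom_coactE; exact: (rho_linf d w).
Qed.

Lemma tsum_ihom_coact U d W V (f : ihom d W V) w (F : V -> H -> U) : bilin F ->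
  \tsum_(g, h <- ihom_coact f) F (g w) h = tsum (rho d f w) F.
Proof.
move=> hF; rewrite -ihom_coactE (tsumC _ _ hF); apply: eq_tsum => g h.
by rewrite (tsum_ten _ _ hF).
Qed.

Fact ihom_coactA d W V (f : ihom d W V) :
  \tsum_(m0, m1 <- mklin (@ihom_coact_lin d W V) f) (m0 ⊗ Delta m1)
  = \tsum_(m0, m1 <- mklin (@ihom_coact_lin d W V) f)
      \tsum_(n0, n1 <- mklin (@ihom_coact_lin d W V) m0) (n0 ⊗ (n1 ⊗ m1)).
Proof.
rewrite /=; apply: ihom_sep => w.
have hb : bilin (fun (g : ihom d W V) (b : tens H H) => g w ⊗ b) by linh.
rewrite !(tsumC _ _ hb).
transitivity (\tsum_(g, h <- ihom_coact f) (g w ⊗ Delta h)).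
  by apply: eq_tsum => g h; rewrite tsum_ten.
rewrite (tsum_ihom_coact _ _ (F := fun v h => v ⊗ Delta h)); last by linh.
have hf x : rho d f x = \tsum_(g, h <- ihom_coact f) g x ⊗ h by rewrite ihom_coactE.
rewrite -(rho_coassoc (e := mklin (@ihom_lin_linear k H d W V)) hf).
apply: eq_tsum => g h; rewrite (tsumC _ _ hb) /=.
rewrite -(tsum_ihom_coact _ _ (F := fun v x => v ⊗ (x ⊗ h))); last by linh.
by apply: eq_tsum => g' x; rewrite tsum_ten.
Qed.

Fact ihom_coact_counit d W V (f : ihom d W V) :
  \tsum_(m0, m1 <- mklin (@ihom_coact_lin d W V) f) counit m1 *: m0 = f.
Proof.
apply: ihom_eq => w /=.
rewrite (tsum_fun _ _ (f := fun g : ihom d W V => g w)); last by linh.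
transitivity (\tsum_(g, h <- ihom_coact f) counit h *: g w); first by [].
rewrite (tsum_ihom_coact _ _ (F := fun v h => counit h *: v)); last by linh.
rewrite tsum_rho; last by linh.
rewrite -[in RHS](coact_counit w) (tsum_fun _ _ (f := f)); last by linh.
apply: eq_tsum => w0 w1; rewrite linearZ_LR /= -[in RHS](coact_counit (f w0)).
rewrite (tsum_fun _ _ (f := fun v => counit w1 *: v)); last by linh.
by apply: eq_tsum => v0 v1; rewrite twist_counit scalerA mulrC.
Qed.

Definition ihom_comod d W V : comod H :=
  Comod (@ihom_coactA d W V) (@ihom_coact_counit d W V).

Lemma ihom_comodE d W V (f : ihom_comod d W V) w :
  \tsum_(g, h <- coact f) (g w ⊗ h) = rho d f w.
Proof. exact: ihom_coactE. Qed.
End IHomComod.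

Section Adjunction.
Variables (k : fieldType) (H : hopfAlgInv k).
Implicit Types (L M N T V W X Y : comod H) (U : lmodType k) (d : side).

(* Tensor product with [X] placed on the side [d] of [Y]: the internal Homs
   satisfy Hom(tensd d T W, V)^H = Hom(T, Hom^d(W, V))^H. *)
Definition tensd d X Y : comod H :=
  match d with Left => tens_comod X Y | Right => tens_comod Y X end.

Definition tend d X Y (x : X) (y : Y) : tensd d X Y :=
  match d return tensd d X Y with Left => x ⊗ y | Right => y ⊗ x end.

Definition tensd_lift d X Y U (F : X -> Y -> U) : tensd d X Y -> U :=
  match d return tensd d X Y -> U with
  | Left => fun z => \tsum_(x, y <- z) F x y
  | Right => fun z => \tsum_(y, x <- z) F x y
  end.

Lemma tend_bilin d X Y : bilin (@tend d X Y).
Proof. by rewrite /tend; case: d; lins. Qed.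
Lemma tensd_lift_lin d X Y U (F : X -> Y -> U) : bilin F ->
  linear (@tensd_lift d X Y U F).
Proof.
by case=> h1 h2; case: d => /=; apply: tsum_lin; split.
Qed.
Lemma tensd_liftE d X Y U (F : X -> Y -> U) x y : bilin F ->
  @tensd_lift d X Y U F (tend d x y) = F x y.
Proof. by case=> h1 h2; case: d => /=; rewrite tsum_ten //; split. Qed.
Lemma tensd_ext d X Y U (f g : tensd d X Y -> U) : linear f -> linear g ->
  (forall x y, f (tend d x y) = g (tend d x y)) -> f =1 g.
Proof. by case: d f g => f g hf hg e; apply: tens_ext => // a b; apply: e. Qed.
Lemma coact_tend d X Y (x : X) (y : Y) : coact (tend d x y) =
  \tsum_(x0, x1 <- coact x) \tsum_(y0, y1 <- coact y)
    (tend d x0 y0 ⊗ smul d x1 y1).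
Proof.
by case: d => /=; rewrite tens_coactE // tsum_swap.
Qed.

Ltac lin5 := first [ lin4 | lazymatch goal with |- linear _ => first
   [ apply: (lin_bill _ (@tend_bilin _ _ _)) | apply: (lin_bilr _ (@tend_bilin _ _ _))] end ].
Ltac linq := repeat lin5.

Section Lift.
Variables (d : side) (X W V : comod H) (F : X -> W -> V).
Hypothesis F_bilin : bilin F.
Hypothesis F_colin : forall x w,
  rho d (F x) w = \tsum_(x0, x1 <- coact x) (F x0 w ⊗ x1).

Let Fl (x : X) : {linear W -> V} := mklin (proj2 F_bilin x).

Fact ihom_lift_rational x : Fl x \in @ihom_pred k H d W V.
Proof.
apply/asboolP; exists (\tsum_(x0, x1 <- coact x) (Fl x0 ⊗ x1)) => w.
rewrite F_colin tsumC; last by linh.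
by apply: eq_tsum => x0 x1; rewrite tsum_ten //; linh.
Qed.
Definition ihom_lift_fun (x : X) : ihom_comod d W V := IHom (ihom_lift_rational x).

Fact ihom_lift_lin : linear ihom_lift_fun.
Proof. by move=> a x y; apply: ihom_eq => w; exact: (proj1 F_bilin). Qed.
Fact ihom_lift_colin x : coact (mklin ihom_lift_lin x)
  = \tsum_(x0, x1 <- coact x) (mklin ihom_lift_lin x0 ⊗ x1).
Proof.
apply: ihom_sep => w; rewrite ihom_coactE.
rewrite tsumC; last by linh.
rewrite [LHS]F_colin; apply: eq_tsum => x0 x1.
by rewrite tsum_ten //; linh.
Qed.
Definition ihom_lift : comodHom X (ihom_comod d W V) := ComodHom ihom_lift_colin.
End Lift.

Lemma rho_coact d W V (f : ihom_comod d W V) w :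
  rho d f w = \tsum_(g, h <- coact f) (g w ⊗ h).
Proof. by rewrite ihom_comodE. Qed.

Fact ihom_bilin d W V : bilin (fun (f : ihom_comod d W V) w => f w).
Proof. by linh. Qed.

Lemma coact_ihom d W V (f : ihom_comod d W V) w : coact (f w)
  = \tsum_(g, h <- coact f) \tsum_(w0, w1 <- coact w) (g w0 ⊗ smul d h w1).
Proof.
rewrite tsum_swap.
transitivity (\tsum_(w0, w1 <- coact w) \tsum_(v, h <- rho d f w0) (v ⊗ smul d h w1)).
  transitivity (\tsum_(w0, w1 <- coact w) \tsum_(a, b <- coact w0)
     \tsum_(v0, v1 <- coact (f a)) (v0 ⊗ smul d (twist d v1 b) w1)); last first.
    by apply: eq_tsum => w0 w1; rewrite tsum_rho //; linh.
  rewrite -(coact_tri (F := fun a b c => \tsum_(v0, v1 <- coact (f a))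
     (v0 ⊗ smul d (twist d v1 b) c))); last by linh.
  rewrite -{1}(coact_counit w) (tsum_fun _ _ (f := fun z => coact (f z))); last by linh.
  apply: eq_tsum => w0 w1; rewrite tsum_swap !linearZ_LR /= [X in _ *: X]tens_repr.
  rewrite (tsum_fun _ _ (f := fun z => counit w1 *: z)); last by linh.
  apply: eq_tsum => v0 v1; rewrite -(linZ (tenr _)) -(smul_twistl d).
  by rewrite (tsum_fun _ _ (tenr _)).
apply: eq_tsum => w0 w1; rewrite rho_coact tsumC; last by linh.
by apply: eq_tsum => g h; rewrite tsum_ten //; linh.
Qed.

(* [Left]:  Hom(T ⊗ W, V)^H -> Hom(T, Hom^l(W, V))^H,
   [Right]: Hom(W ⊗ T, V)^H -> Hom(T, Hom^r(W, V))^H; the inverse is [adjV]. *)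
Section Adj.
Variables (d : side) (T W V : comod H).

Fact adj_bilin (g : comodHom (tensd d T W) V) : bilin (fun t w => g (tend d t w)).
Proof. by linq. Qed.
Fact adj_colin (g : comodHom (tensd d T W) V) t w :
  rho d (fun w => g (tend d t w)) w
  = \tsum_(t0, t1 <- coact t) (g (tend d t0 w) ⊗ t1).
Proof.
transitivity (\tsum_(w0, w1 <- coact w) \tsum_(a, b <- coact w0)
   \tsum_(t0, t1 <- coact t) (g (tend d t0 a) ⊗ twist d (smul d t1 b) w1)).
  rewrite /rho; apply: eq_tsum => w0 w1.
  rewrite comodHomP coact_tend tsumC; last by linq.
  rewrite tsumC; last by linq.
  rewrite tsum_swap; apply: eq_tsum => t0 t1.
  rewrite tsumC; last by linq.
  apply: eq_tsum => a b.
  rewrite tsum_ten; last by linq.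
  by rewrite tsum_ten //; linq.
rewrite -(coact_tri (F := fun a b c => \tsum_(t0, t1 <- coact t)
   (g (tend d t0 a) ⊗ twist d (smul d t1 b) c))); last by linq.
rewrite -[in RHS](coact_counit w).
rewrite [RHS](tsum_fun _ _ (f := fun w => \tsum_(t0, t1 <- coact t)
  (g (tend d t0 w) ⊗ t1))); last by linq.
apply: eq_tsum => w0 w1; rewrite tsum_swap; apply: eq_tsum => t0 t1.
rewrite -(tsum_fun _ _ (tenr _)) (twist_smull d) (linZ (tenr _)).
by rewrite (linZ (proj2 (@tend_bilin d T W) t0)) linearZ_LR /= (linZ (tenl _)).
Qed.
Definition adj (g : comodHom (tensd d T W) V) : comodHom T (ihom_comod d W V) :=
  ihom_lift (adj_bilin g) (adj_colin g).
Lemma adjE g t w : adj g t w = g (tend d t w).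
Proof. by []. Qed.

Section AdjV.
Variable f : comodHom T (ihom_comod d W V).
Fact adjV_bilin : bilin (fun t w => f t w).
Proof. by linq. Qed.
Fact adjV_colin z : coact (mklin (tensd_lift_lin (d := d) adjV_bilin) z)
  = \tsum_(z0, z1 <- coact z) (mklin (tensd_lift_lin (d := d) adjV_bilin) z0 ⊗ z1).
Proof.
move: z; apply: tensd_ext => [||t w]; [by linq|by linq|].
rewrite coact_tend /= tensd_liftE; last by linq.
rewrite coact_ihom comodHomP tsumC; last by linq; exact: (tensd_lift_lin adjV_bilin).
rewrite tsumC; last by linq; exact: (tensd_lift_lin adjV_bilin).
apply: eq_tsum => t0 t1; rewrite tsumC; last by linq; exact: (tensd_lift_lin adjV_bilin).
rewrite tsum_ten; last by linq; exact: (tensd_lift_lin adjV_bilin).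
apply: eq_tsum => w0 w1; rewrite tsum_ten; last by linq; exact: (tensd_lift_lin adjV_bilin).
by rewrite /= tensd_liftE //; linq.
Qed.
Definition adjV : comodHom (tensd d T W) V := ComodHom adjV_colin.
Lemma adjVE t w : adjV (tend d t w) = f t w.
Proof. by rewrite /= tensd_liftE //; linq. Qed.
End AdjV.

Lemma adjK : cancel adj adjV.
Proof.
move=> g; apply: comodHom_eq; apply: tensd_ext => [||t w]; [by linq|by linq|].
by rewrite adjVE.
Qed.
Lemma adjVK : cancel adjV adj.
Proof.
move=> f; apply: comodHom_eq => t; apply: ihom_eq => w.
by rewrite adjE adjVE.
Qed.
End Adj.

Section Unitor.
Variables (d : side) (M : comod H).
Fact unitor_bilin : bilin (fun (c : unit_comod H) (m : M) => (c : k) *: m).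
Proof.
split=> [m|c] a u v; last by rewrite scalerDr !scalerA mulrC.
by rewrite scalerDl -scalerA.
Qed.
Fact unitor_colin z :
  coact (mklin (tensd_lift_lin (d := d) unitor_bilin) z)
  = \tsum_(z0, z1 <- coact z) (mklin (tensd_lift_lin (d := d) unitor_bilin) z0 ⊗ z1).
Proof.
move: z; apply: tensd_ext => [||c m]; [by linq|by linq|].
rewrite coact_tend /= tensd_liftE; last exact: unitor_bilin.
rewrite tsum_ten; last by linq; exact: (tensd_lift_lin unitor_bilin).
rewrite tsumC; last by linq; exact: (tensd_lift_lin unitor_bilin).
rewrite linearZ_LR /= [X in _ *: X]tens_repr.
rewrite (tsum_fun _ _ (f := fun z => (c : k) *: z)); last by linq; exact: (tensd_lift_lin unitor_bilin).
apply: eq_tsum => m0 m1.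
rewrite tsum_ten; last by linq; exact: (tensd_lift_lin unitor_bilin).
rewrite /= tensd_liftE; last exact: unitor_bilin.
rewrite -(linZ (tenl _)); congr (_ ⊗ _).
by rewrite /smul; case: d; rewrite ?mul1r ?mulr1.
Qed.
Definition unitor : comodHom (tensd d (unit_comod H) M) M := ComodHom unitor_colin.
Lemma unitorE c m : unitor (tend d c m) = (c : k) *: m.
Proof. by rewrite /= tensd_liftE //; exact: unitor_bilin. Qed.

Fact unitorV_lin : linear (fun m : M => tend d (1 : unit_comod H) m).
Proof. by linq. Qed.
Fact unitorV_colin m : coact (mklin unitorV_lin m)
  = \tsum_(m0, m1 <- coact m) (mklin unitorV_lin m0 ⊗ m1).
Proof.
rewrite /= coact_tend tsum_ten; last by linq.
apply: eq_tsum => m0 m1; congr (_ ⊗ _).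
by rewrite /smul; case: d; rewrite ?mul1r ?mulr1.
Qed.
Definition unitorV : comodHom M (tensd d (unit_comod H) M) := ComodHom unitorV_colin.

Lemma unitorK : comod_comp unitor unitorV = comod_id M.
Proof.
by apply: comodHom_eq => m; rewrite [LHS]unitorE scale1r.
Qed.
Lemma unitorVK : comod_comp unitorV unitor = comod_id _.
Proof.
apply: comodHom_eq; apply: tensd_ext => [||c m]; [by linq|by linq|].
transitivity (unitorV (unitor (tend d c m))); first by [].
rewrite unitorE; transitivity (tend d (1 : unit_comod H) ((c : k) *: m)); first by [].
rewrite (linZ (proj2 (@tend_bilin d _ _) _)) -(linZ (proj1 (@tend_bilin d _ _) _)).
by congr (tend _ _ _); exact: mulr1.
Qed.
End Unitor.

Section Functoriality.
Variable d : side.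

Fact ihom_post_bilin W V V' (th : comodHom V V') :
  bilin (fun (f : ihom_comod d W V) w => th (f w)).
Proof. by linq. Qed.
Fact ihom_post_colin W V V' (th : comodHom V V') (f : ihom_comod d W V) w :
  rho d (fun w => th (f w)) w = \tsum_(g, h <- coact f) (th (g w) ⊗ h).
Proof.
transitivity (\tsum_(v, h <- rho d f w) (th v ⊗ h)).
  rewrite tsum_rho; last by linq.
  apply: eq_tsum => w0 w1; rewrite comodHomP tsumC; last by linq.
  by apply: eq_tsum => v0 v1; rewrite tsum_ten //; linq.
rewrite rho_coact tsumC; last by linq.
by apply: eq_tsum => g h; rewrite tsum_ten //; linq.
Qed.
Definition ihom_post W V V' (th : comodHom V V') :
  comodHom (ihom_comod d W V) (ihom_comod d W V') :=
  ihom_lift (@ihom_post_bilin W V V' th) (@ihom_post_colin W V V' th).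

Fact ihom_pre_bilin W' W V (e : comodHom W' W) :
  bilin (fun (f : ihom_comod d W V) w => f (e w)).
Proof. by linq. Qed.
Fact ihom_pre_colin W' W V (e : comodHom W' W) (f : ihom_comod d W V) w :
  rho d (fun w => f (e w)) w = \tsum_(g, h <- coact f) (g (e w) ⊗ h).
Proof.
rewrite -rho_coact /rho comodHomP [RHS]tsumC; last by linq.
by apply: eq_tsum => w0 w1; rewrite tsum_ten //; linq.
Qed.
Definition ihom_pre W' W V (e : comodHom W' W) :
  comodHom (ihom_comod d W V) (ihom_comod d W' V) :=
  ihom_lift (@ihom_pre_bilin W' W V e) (@ihom_pre_colin W' W V e).
End Functoriality.

Section Curry.
Variables (d : side) (X Y M : comod H).
Let E := ihom_comod d (tensd d X Y) M.

Fact curry_sub y : bilin (fun (f : E) x => f (tend d x y)).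
Proof. by linq. Qed.
Fact curry_bilin :
  bilin (fun (z : tensd d E X) y => tensd_lift (fun (f : E) x => f (tend d x y)) z).
Proof.
split=> [y|z]; first exact/tensd_lift_lin/curry_sub.
move=> a u v.
have lr : linear (fun z0 : tensd d E X =>
    a *: tensd_lift (fun (f : E) x => f (tend d x u)) z0
    + tensd_lift (fun (f : E) x => f (tend d x v)) z0).
  move=> b z1 z2; rewrite !(tensd_lift_lin (curry_sub _)).
  by rewrite !scalerDr !scalerA (mulrC a b) addrACA.
move: z; apply: (tensd_ext (tensd_lift_lin (curry_sub _)) lr) => f x.
rewrite !tensd_liftE; try exact: curry_sub.
by rewrite (proj2 (@tend_bilin d X Y)) linearP.
Qed.

Fact curry_colin_ten (f : E) x y : rho d (fun y => f (tend d x y)) y =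
  \tsum_(g, h <- coact f) \tsum_(x0, x1 <- coact x)
    (g (tend d x0 y) ⊗ smul d h x1).
Proof.
rewrite tsum_swap.
transitivity (\tsum_(x0, x1 <- coact x)
   \tsum_(m, h <- rho d f (tend d x0 y)) (m ⊗ smul d h x1)); last first.
  apply: eq_tsum => x0 x1; rewrite rho_coact tsumC; last by linq.
  by apply: eq_tsum => g h; rewrite tsum_ten //; linq.
pose F x0 x1 x2 := \tsum_(y0, y1 <- coact y) \tsum_(m0, m1 <- coact (f (tend d x0 y0)))
  (m0 ⊗ smul d (twist d (twist d m1 y1) x1) x2).
transitivity (\tsum_(x0, x1 <- coact x) \tsum_(a, b <- coact x0) F a b x1); last first.
  apply: eq_tsum => x0 x1; rewrite tsum_rho; last by linq.
  rewrite coact_tend tsumC; last by linq.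
  apply: eq_tsum => a b; rewrite tsumC; last by linq.
  apply: eq_tsum => y0 y1; rewrite tsum_ten; last by linq.
  by apply: eq_tsum => m0 m1; rewrite twist_smul.
rewrite -coact_tri; last by rewrite /F; linq.
rewrite /rho -{1}(coact_counit x).
rewrite [LHS](tsum_fun _ _ (f := fun x => \tsum_(y0, y1 <- coact y)
  \tsum_(m0, m1 <- coact (f (tend d x y0))) (m0 ⊗ twist d m1 y1))); last by linq.
apply: eq_tsum => x0 x1; rewrite /F tsum_swap; apply: eq_tsum => y0 y1.
rewrite tsum_swap (linZ (proj1 (@tend_bilin d X Y) y0)) !linearZ_LR /=.
rewrite (linZ (tsum_lin _)); last by linq.
rewrite (tsum_fun _ _ (f := fun z => counit x1 *: z)); last by linq.
apply: eq_tsum => m0 m1; rewrite -(linZ (tenr _)) -(smul_twistl d).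
by rewrite (tsum_fun _ _ (tenr _)).
Qed.

Fact curry_colin (z : tensd d E X) y :
  rho d (fun y => tensd_lift (fun (f : E) x => f (tend d x y)) z) y
  = \tsum_(z0, z1 <- coact z)
      (tensd_lift (fun (f : E) x => f (tend d x y)) z0 ⊗ z1).
Proof.
pose phi z := mklin (proj2 curry_bilin z).
have lphi : linear phi.
  by move=> a z1 z2; apply: linear_eq => w; exact: (proj1 curry_bilin).
have l1 : linear (fun z => rho d (phi z) y).
  by move=> a z1 z2; rewrite lphi; exact: (rho_linf d y).
have l2 : linear (fun z : tensd d E X => \tsum_(z0, z1 <- coact z)
      (tensd_lift (fun (f : E) x => f (tend d x y)) z0 ⊗ z1)).
  by linq; exact: tensd_lift_lin (curry_sub y).
move: z; apply: (tensd_ext l1 l2) => f x.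
rewrite coact_tend tsumC; last by linq; exact: tensd_lift_lin (curry_sub y).
transitivity (rho d (fun y => f (tend d x y)) y).
  rewrite /rho; apply: eq_tsum => y0 y1 /=.
  by rewrite tensd_liftE //; exact: curry_sub.
rewrite curry_colin_ten; apply: eq_tsum => g h.
rewrite tsumC; last by linq; exact: tensd_lift_lin (curry_sub y).
apply: eq_tsum => x0 x1.
rewrite tsum_ten; last by linq; exact: tensd_lift_lin (curry_sub y).
by rewrite tensd_liftE //; exact: curry_sub.
Qed.

(* f |-> (x |-> (y |-> f(x ⊗ y))) for [Left], f(y ⊗ x) for [Right]:
   (W ⊗ V) ▷ M -> W ▷ (V ▷ M) is [curry Left W V M] and
   M ◁ (W ⊗ V) -> (M ◁ W) ◁ V is [curry Right V W M]. *)
Definition curry : comodHom E (ihom_comod d X (ihom_comod d Y M)) :=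
  adj (ihom_lift curry_bilin curry_colin).
Lemma curryE (f : E) x y : curry f x y = f (tend d x y).
Proof. by rewrite /= tensd_liftE //; exact: curry_sub. Qed.
End Curry.

Section Flip.
Variables (W V M : comod H).
Let E := ihom_comod Left W (ihom_comod Right V M).

Fact flip_sub w : bilin (fun (f : E) (v : V) => f w v).
Proof.
split=> [v|f] a x y; last by rewrite linearP.
by [].
Qed.
Fact flip_bilin :
  bilin (fun (z : tensd Right E V) w => tensd_lift (fun (f : E) v => f w v) z).
Proof.
split=> [w|z]; first exact/tensd_lift_lin/flip_sub.
move=> a x y.
have lr : linear (fun z0 : tensd Right E V =>
    a *: tensd_lift (fun (f : E) v => f x v) z0
    + tensd_lift (fun (f : E) v => f y v) z0).
  move=> b z1 z2; rewrite !(tensd_lift_lin (flip_sub _)).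
  by rewrite !scalerDr !scalerA (mulrC a b) addrACA.
move: z; apply: (tensd_ext (tensd_lift_lin (flip_sub _)) lr) => f v.
rewrite !tensd_liftE; try exact: flip_sub.
by rewrite linearP.
Qed.

Fact flip_colin_ten (f : E) v w : rho Left (fun w => f w v) w =
  \tsum_(g, h <- coact f) \tsum_(v0, v1 <- coact v) (g w v0 ⊗ smul Right h v1).
Proof.
have bw v0 v1 : bilin (fun (g : ihom_comod Right V M) (h : H) => g v0 ⊗ (v1 * h)).
  by linq.
transitivity (\tsum_(v0, v1 <- coact v)
   \tsum_(g, h <- rho Left f w) (g v0 ⊗ (v1 * h))); last first.
  rewrite [RHS]tsum_swap; apply: eq_tsum => v0 v1.
  rewrite rho_coact tsumC; last exact: bw.
  by apply: eq_tsum => g h; rewrite tsum_ten.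
transitivity (\tsum_(w0, w1 <- coact w) \tsum_(v0, v1 <- coact v)
  \tsum_(m, h <- rho Right (f w0) v0) (m ⊗ (v1 * (h * antipode w1)))); last first.
  rewrite tsum_swap; apply: eq_tsum => v0 v1.
  rewrite tsum_rho; last exact: bw.
  apply: eq_tsum => w0 w1; rewrite rho_coact tsumC; last by linq.
  by apply: eq_tsum => g h; rewrite tsum_ten //; linq.
rewrite /rho; apply: eq_tsum => w0 w1.
transitivity (\tsum_(v0, v1 <- coact v) \tsum_(m, h <- rho Right (f w0) v0)
   (m ⊗ ((v1 * h) * antipode w1))); last first.
  by apply: eq_tsum => v0 v1; apply: eq_tsum => m h; rewrite mulrA.
rewrite coact_ihom tsum_swap tsumC; last by linq.
apply: eq_tsum => v0 v1; rewrite rho_coact !tsumC; try by linq.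
by apply: eq_tsum => g h; rewrite !tsum_ten //; linq.
Qed.

Fact flip_colin (z : tensd Right E V) w :
  rho Left (fun w => tensd_lift (fun (f : E) v => f w v) z) w
  = \tsum_(z0, z1 <- coact z) (tensd_lift (fun (f : E) v => f w v) z0 ⊗ z1).
Proof.
pose phi z := mklin (proj2 flip_bilin z).
have lphi : linear phi.
  by move=> a z1 z2; apply: linear_eq => x; exact: (proj1 flip_bilin).
have l1 : linear (fun z => rho Left (phi z) w).
  by move=> a z1 z2; rewrite lphi; exact: (rho_linf Left w).
have l2 : linear (fun z : tensd Right E V => \tsum_(z0, z1 <- coact z)
      (tensd_lift (fun (f : E) v => f w v) z0 ⊗ z1)).
  by linq; exact: ihom_lin_linear.
move: z; apply: (tensd_ext l1 l2) => f v.
rewrite coact_tend tsumC; last by linq; exact: ihom_lin_linear.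
transitivity (rho Left (fun w => f w v) w).
  rewrite /rho; apply: eq_tsum => w0 w1.
  by rewrite [phi _ _]tensd_liftE //; exact: flip_sub.
rewrite flip_colin_ten; apply: eq_tsum => g h.
rewrite tsumC; last by linq; exact: ihom_lin_linear.
apply: eq_tsum => v0 v1.
rewrite tsum_ten; last by linq; exact: ihom_lin_linear.
by rewrite tensd_liftE //; exact: flip_sub.
Qed.

(* W ▷ (M ◁ V) -> (W ▷ M) ◁ V, f |-> (v |-> (w |-> f(w)(v))). *)
Definition flip : comodHom E (ihom_comod Right V (ihom_comod Left W M)) :=
  adj (ihom_lift flip_bilin flip_colin).
Lemma flipE (f : E) v w : flip f v w = f w v.
Proof. by rewrite [LHS]tensd_liftE //; exact: flip_sub. Qed.
End Flip.
End Adjunction.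

Notation "W ▷ M" := (ihom_comod Left W M) (at level 40, left associativity).
Notation "M ◁ W" := (ihom_comod Right W M) (at level 40, left associativity).

Section EvUnit.
Variables (k : fieldType) (H : hopfAlgInv k) (d : side) (M : comod H).

Fact ev_unit_lin : linear (fun f : ihom_comod d (unit_comod H) M => f 1).
Proof. by linh. Qed.
Fact ev_unit_colin f : coact (mklin ev_unit_lin f)
  = \tsum_(f0, f1 <- coact f) (mklin ev_unit_lin f0 ⊗ f1).
Proof.
rewrite [LHS](coact_ihom f (1 : unit_comod H)); apply: eq_tsum => g h.
rewrite [LHS]tsum_ten; last by linh.
by congr (_ ⊗ _); case: d; rewrite /= ?mulr1 ?mul1r.
Qed.
(* k ▷ M -> M and M ◁ k -> M, the identifications under which tau_k = Id_M. *)
Definition ev_unit : comodHom (ihom_comod d (unit_comod H) M) M :=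
  ComodHom ev_unit_colin.

Fact cst_unit_bilin : bilin (fun (m : M) (c : unit_comod H) => (c : k) *: m).
Proof. by case: (@unitor_bilin k H M). Qed.
Fact cst_unit_colin (m : M) (c : unit_comod H) :
  rho d (fun c : unit_comod H => (c : k) *: m) c
  = \tsum_(m0, m1 <- coact m) (((c : k) *: m0) ⊗ m1).
Proof.
rewrite /rho [LHS]tsum_ten.
  rewrite linearZ_LR /= [X in tsum (_ *: X) _]tens_repr.
  rewrite (linZ (tsum_lin _)) ?(tsumC _ _); try by lint.
  rewrite (tsum_fun _ _ (f := fun x => (c : k) *: x)); last by lint.
  by apply: eq_tsum => m0 m1; rewrite tsum_ten ?twist1 ?(linZ (tenl _)) //; lint.
split=> [h|a]; last by lint.
move=> a x y; rewrite scalerDl -scalerA linearP.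
by rewrite tsum_lin //; lint.
Qed.

Lemma ev_unit_iso : is_comod_iso ev_unit.
Proof.
exists (ihom_lift cst_unit_bilin cst_unit_colin).
split; apply: comodHom_eq; last by move=> m; exact: scale1r.
move=> f; apply: ihom_eq => c; transitivity ((c : k) *: f 1); first by [].
by rewrite -linearZ; congr (f _); exact: mulr1.
Qed.
End EvUnit.

Record category := Category {
  obj :> Type;
  hom : obj -> obj -> Type;
  idm : forall x, hom x x;
  compm : forall x y z, hom y z -> hom x y -> hom x z;
  comp_idl : forall x y (f : hom x y), compm (idm y) f = f;
  comp_idr : forall x y (f : hom x y), compm f (idm x) = f;
  compA : forall w x y z (h : hom y z) (g : hom x y) (f : hom w x),
    compm h (compm g f) = compm (compm h g) f
}.
Arguments hom {c} x y : rename.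
Arguments idm {c} x : rename.
Arguments compm {c x y z} g f : rename.

Record functor (C D : category) := Functor {
  fobj :> C -> D;
  fmap : forall x y : C, hom x y -> hom (fobj x) (fobj y);
  fmap_id : forall x : C, fmap (idm x) = idm (fobj x);
  fmap_comp : forall (x y z : C) (g : hom y z) (f : hom x y),
    fmap (compm g f) = compm (fmap g) (fmap f)
}.
Arguments fmap {C D} f {x y} u : rename.

Definition functor_id (C : category) : functor C C :=
  @Functor C C (fun x => x) (fun x y f => f) (fun x => erefl)
    (fun x y z g f => erefl).

Section FunctorComp.
Variables (C D E : category) (G : functor D E) (F : functor C D).
Fact functor_comp_id (x : C) : fmap G (fmap F (idm x)) = idm (G (F x)).
Proof. by rewrite !fmap_id. Qed.
Fact functor_comp_comp (x y z : C) (g : hom y z) (f : hom x y) :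
  fmap G (fmap F (compm g f)) = compm (fmap G (fmap F g)) (fmap G (fmap F f)).
Proof. by rewrite !fmap_comp. Qed.
Definition functor_comp : functor C E :=
  @Functor C E (fun x => G (F x)) (fun x y f => fmap G (fmap F f))
    functor_comp_id functor_comp_comp.
End FunctorComp.

Definition is_iso (C : category) (x y : C) (f : hom x y) : Prop :=
  exists g : hom y x, compm g f = idm x /\ compm f g = idm y.

Definition nat_isomorphic (C D : category) (F G : functor C D) : Prop :=
  exists eta : forall x : C, hom (F x) (G x),
    (forall x, is_iso (eta x)) /\
    (forall (x y : C) (f : hom x y),
       compm (fmap G f) (eta x) = compm (eta y) (fmap F f)).

Definition equivalent (C D : category) : Prop :=
  exists (F : functor C D) (G : functor D C),
    nat_isomorphic (functor_comp G F) (functor_id C) /\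
    nat_isomorphic (functor_comp F G) (functor_id D).

Definition full_subcategory (C : category) (P : C -> Prop) : category :=
  @Category {x : C | P x} (fun x y => hom (sval x) (sval y))
    (fun x => idm (sval x)) (fun x y z g f => compm g f)
    (fun x y f => comp_idl f) (fun x y f => comp_idr f)
    (fun w x y z h g f => compA h g f).

Section AYD.
Variables (k : fieldType) (H : hopfAlg k).

Record aYD := AYD {
  aYD_comod :> comod H;
  act : H -> aYD_comod -> aYD_comod;
  act_bilin : bilin act;
  act1 : forall m, act 1 m = m;
  actM : forall g h m, act (g * h) m = act g (act h m);
  (* h12 stands for the first leg of Delta h, so that
     h1 ⊗ h2 ⊗ h3 = (Delta ⊗ 1) (Delta h). *)
  act_coact : forall h m, coact (act h m) =
    \tsum_(h12, h3 <- Delta h) \tsum_(h1, h2 <- Delta h12)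
      \tsum_(m0, m1 <- coact m) (act h2 m0 ⊗ (h3 * m1 * antipode h1))
}.

Definition stable (M : aYD) : Prop :=
  forall m : M, \tsum_(m0, m1 <- coact m) act m1 m0 = m.

Record aYDHom (M N : aYD) := AYDHom {
  aYDHom_comod :> comodHom M N;
  aYDHomP : forall h m, aYDHom_comod (act h m) = act h (aYDHom_comod m)
}.

Lemma aYDHom_eq M N (f g : aYDHom M N) : f =1 g -> f = g.
Proof.
case: f g => [f hf] [g hg] /= /comodHom_eq e; subst g.
by rewrite (Prop_irrelevance hf hg).
Qed.

Fact aYD_id_subproof (M : aYD) h (m : M) :
  comod_id M (act h m) = act h (comod_id M m).
Proof. by []. Qed.
Definition aYD_id (M : aYD) : aYDHom M M := AYDHom (@aYD_id_subproof M).

Fact aYD_comp_subproof L M N (g : aYDHom M N) (f : aYDHom L M) h m :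
  comod_comp g f (act h m) = act h (comod_comp g f m).
Proof. by rewrite /= !aYDHomP. Qed.
Definition aYD_comp L M N (g : aYDHom M N) (f : aYDHom L M) : aYDHom L N :=
  AYDHom (@aYD_comp_subproof L M N g f).

Definition aYD_cat : category.
Proof.
by refine (@Category aYD aYDHom aYD_id aYD_comp _ _ _) => *; apply: aYDHom_eq.
Defined.

Definition saYD_cat : category := @full_subcategory aYD_cat stable.
End AYD.

Section Center.
Variables (k : fieldType) (H : hopfAlgInv k).

Record centerObj := CenterObj {
  center_comod :> comod H;
  tau : forall W : comod H, comodHom (W ▷ center_comod) (center_comod ◁ W);
  tau_iso : forall W, is_comod_iso (tau W);
  tau_natural : forall (W' W : comod H) (e : comodHom W' W),
    comod_comp (tau W') (ihom_pre Left center_comod e)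
    = comod_comp (ihom_pre Right center_comod e) (tau W);
  tau_unit : comod_comp (ev_unit Right center_comod) (tau (unit_comod H))
    = ev_unit Left center_comod;
  tau_tensor : forall W V : comod H,
    comod_comp (curry Right V W center_comod) (tau (tens_comod W V))
    = comod_comp (ihom_post Right V (tau W))
        (comod_comp (flip W V center_comod)
           (comod_comp (ihom_post Left W (tau V)) (curry Left W V center_comod)))
}.
Arguments tau : clear implicits.

Record centerHom (M N : centerObj) := CenterHom {
  centerHom_comod :> comodHom M N;
  centerHomP : forall W : comod H,
    comod_comp (ihom_post Right W centerHom_comod) (tau M W)
    = comod_comp (tau N W) (ihom_post Left W centerHom_comod)
}.

Lemma centerHom_eq M N (f g : centerHom M N) : f =1 g -> f = g.
Proof.
case: f g => [f hf] [g hg] /= /comodHom_eq e; subst g.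
by rewrite (Prop_irrelevance hf hg).
Qed.

Lemma ihom_post_id d (W M : comod H) : ihom_post d W (comod_id M) = comod_id _.
Proof. by apply: comodHom_eq => f; apply: ihom_eq. Qed.
Lemma ihom_post_comp d (W L M N : comod H) (g : comodHom M N) (f : comodHom L M) :
  ihom_post d W (comod_comp g f) = comod_comp (ihom_post d W g) (ihom_post d W f).
Proof. by apply: comodHom_eq => u; apply: ihom_eq. Qed.
Lemma comod_compA (A B C D : comod H) (h : comodHom C D) (g : comodHom B C)
  (f : comodHom A B) : comod_comp h (comod_comp g f) = comod_comp (comod_comp h g) f.
Proof. exact: comodHom_eq. Qed.

Fact center_id_subproof (M : centerObj) W :
  comod_comp (ihom_post Right W (comod_id M)) (tau M W)
  = comod_comp (tau M W) (ihom_post Left W (comod_id M)).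
Proof. by rewrite !ihom_post_id; apply: comodHom_eq. Qed.
Definition center_id (M : centerObj) : centerHom M M :=
  CenterHom (@center_id_subproof M).

Fact center_comp_subproof L M N (g : centerHom M N) (f : centerHom L M) W :
  comod_comp (ihom_post Right W (comod_comp g f)) (tau L W)
  = comod_comp (tau N W) (ihom_post Left W (comod_comp g f)).
Proof.
rewrite !ihom_post_comp -comod_compA centerHomP !comod_compA.
by rewrite centerHomP.
Qed.
Definition center_comp L M N (g : centerHom M N) (f : centerHom L M) :
  centerHom L N := CenterHom (@center_comp_subproof L M N g f).

Definition center_cat : category.
Proof.
by refine (@Category centerObj centerHom center_id center_comp _ _ _) => *;
  apply: centerHom_eq.
Defined.

(* Hom(M, M)^H = Hom(k ⊗ M, M)^H -> Hom(k, M ▷ M)^H -> Hom(k, M ◁ M)^H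
   -> Hom(M ⊗ k, M)^H = Hom(M, M)^H. *)
Definition hom_transport (M : centerObj) (g : comodHom M M) : comodHom M M :=
  comod_comp
    (adjV (comod_comp (tau M M) (adj (comod_comp g (unitor Left M)))))
    (unitorV Right M).

Definition center'_cat : category :=
  @full_subcategory center_cat
    (fun M : centerObj => hom_transport (comod_id M) = comod_id M).
End Center.
Arguments tau {k H} M W : rename.

(* Main.v *)
From HB Require Import structures.
Require Import Defs.
From mathcomp Require Import all_boot all_algebra.
From mathcomp Require Import boolp.

(** An anti-Yetter-Drinfeld module M acts on internal Homs by
    tau_W f (w) = w_1 f(w_0), with inverse f |-> S^-1(w_1) f(w_0); colinearity of
    tau is the aYD condition and tau_(W ⊗ V) = tau_W tau_V is associativity of the
    action.  Conversely, given (M, tau), the value tau_W f (w) depends only on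
    f(w_0) ⊗ w_1: if this tensor vanishes, then f vanishes on the subcomodule
    generated by w, so tau_W f (w) = 0 by naturality.  This defines a linear map
    M ⊗ H -> M (additivity comes from direct sums of comodules, totality from
    finite-dimensional subcomodules of H, on which every linear map is rational),
    which is the action of H, and tau is then given by the formula above.
    Finally Id_M corresponds to the element Id of M ▷ M, which tau_M sends to
    m |-> m_1 m_0. *)

Set Implicit Arguments.
Unset Strict Implicit.
Unset Printing Implicit Defensive.
Import GRing.Theory.
Local Open Scope ring_scope.

(** * Dual bases and cyclic subcomodules *)

(** If [b i] were a combination of the other [b j], bilinearity would absorb its term into theirs
    and leave [n.-1] terms. So [b i] lies outside their span and [functional] separates it. A
    general [F] serves both legs of a tensor. *)
Lemma minimal_dual (k : fieldType) (A B U : lmodType k) (F : A -> B -> U) n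
    (a : 'I_n -> A) (b : 'I_n -> B) : bilin F ->
  (forall (a' : 'I_n.-1 -> A) (b' : 'I_n.-1 -> B),
     \sum_i F (a' i) (b' i) <> \sum_i F (a i) (b i)) ->
  forall i, exists psi : {scalar B}, forall j, psi (b j) = (i == j)%:R.
Proof.
move=> [Fl Fr] min i.
pose Q y := exists c : 'I_n.-1 -> k, y = \sum_j c j *: b (lift i j).
have [||[c ebi]|psi [psi0 psi1]] := @functional k B Q _ _ (b i).
- by exists (fun=> 0); rewrite big1 // => j _; rewrite scale0r.
- move=> x _ _ [c ->] [d ->]; exists (fun j => x * c j + d j).
  rewrite scaler_sumr -big_split; apply: eq_bigr => j _ /=.
  by rewrite scalerDl scalerA.
- apply: (min (fun j => c j *: a i + a (lift i j)) (b \o lift i)).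
  rewrite [RHS](bigD1_ord i) //= ebi (lin_sum (Fr _)) -big_split.
  by apply: eq_bigr => j _ /=; rewrite Fl (linZ (Fr _)).
- exists psi => j; have [<-|ij] := eqVneq i j; first by rewrite psi1.
  have [j' -> _] := unlift_some ij.
  apply: psi0; exists (fun l => (l == j')%:R).
  rewrite (bigD1 j') //= eqxx scale1r big1 ?addr0 // => l /negPf ->.
  by rewrite scale0r.
Qed.

(** In a presentation of [t] with the least number of terms both legs are linearly independent, by
    [minimal_dual] applied to each leg. *)
Lemma tens_dual_bases (k : fieldType) (A B : lmodType k) (t : tens A B) :
  exists n (a : 'I_n -> A) (b : 'I_n -> B)
    (phi : 'I_n -> {scalar A}) (psi : 'I_n -> {scalar B}),
  [/\ t = \sum_i a i ⊗ b i, forall i j, phi i (a j) = (i == j)%:R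
    & forall i j, psi i (b j) = (i == j)%:R].
Proof.
pose rep n := exists (a : 'I_n -> A) (b : 'I_n -> B), t = \sum_i a i ⊗ b i.
have ex_rep : exists n, `[< rep n >].
  exists (size (repr t)); apply/asboolP.
  exists (fun i => (nth (0, 0) (repr t) i).1), (fun i => (nth (0, 0) (repr t) i).2).
  rewrite [LHS]tens_repr /tsum (big_nth (0, 0)) big_mkord.
  by apply: eq_bigr.
case: (ex_minnP ex_rep) => n /asboolP[a [b et]] min; exists n, a, b.
(* An index [i] forces [n > 0], so [n.-1] terms would contradict minimality. *)
have nrep : 'I_n -> ~ rep n.-1.
  by move=> i /asboolP/min; rewrite leqNgt prednK ?leqnn // (leq_ltn_trans _ (ltn_ord i)).
have psiP i : exists psi : {scalar B}, forall j, psi (b j) = (i == j)%:R.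
  apply: (@minimal_dual _ _ _ _ (fun a b => a ⊗ b) n a b); first by lins.
  by move=> a' b' e; apply: (nrep i); exists a', b'; rewrite e.
have phiP i : exists phi : {scalar A}, forall j, phi (a j) = (i == j)%:R.
  apply: (@minimal_dual _ _ _ _ (fun b a => a ⊗ b) n b a); first by lins.
  by move=> b' a' e; apply: (nrep i); exists a', b'; rewrite e.
exists (fun i => projT1 (cid (phiP i))), (fun i => projT1 (cid (psiP i))).
split=> // i j; first exact: (projT2 (cid (phiP i))).
exact: (projT2 (cid (psiP i))).
Qed.

Section Retract.
Variables (k : fieldType) (H : hopfAlg k) (W : comod H) (F : lmodType k).
Variables (i : {linear F -> W}) (p : {linear W -> F}).
Hypothesis pK : cancel i p.
Hypothesis ip_coact : forall x,
  \tsum_(c0, c1 <- coact (i x)) i (p c0) ⊗ c1 = coact (i x).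

(** The subcomodule [i(F)] of [W] transported to [F]: since [i p] is a projection onto [i(F)],
    [ip_coact] says that [coact] maps [i(F)] into [i(F) ⊗ H]. *)
Definition retract_coact (x : F) : tens F H := \tsum_(c0, c1 <- coact (i x)) p c0 ⊗ c1.
Fact retract_coact_lin : linear retract_coact.
Proof. by rewrite /retract_coact; lins. Qed.
Let delta := mklin retract_coact_lin.

(** Coassociativity of [W] with [p] applied to the first leg; [ip_coact] accounts for the [i p]
    inside the inner coaction. *)
Fact retract_coactA x : \tsum_(m0, m1 <- delta x) (m0 ⊗ Delta m1)
  = \tsum_(m0, m1 <- delta x) \tsum_(n0, n1 <- delta m0) (n0 ⊗ (n1 ⊗ m1)).
Proof.
rewrite /= !tsumC; try by lins; exact: retract_coact_lin.
transitivity (\tsum_(c0, c1 <- coact (i x)) \tsum_(n0, n1 <- coact c0)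
  (p n0 ⊗ (n1 ⊗ c1))); last first.
  rewrite -[X in tsum X _ = _]ip_coact tsumC; last by lins.
  apply: eq_tsum => c0 c1; rewrite !tsum_ten; last first.
  - by lins; exact: retract_coact_lin.
  - by lins.
  by rewrite tsumC; [apply: eq_tsum => a b; rewrite tsum_ten //|]; lins.
pose G (y : tens W (tens H H)) := \tsum_(a, b <- y) p a ⊗ b.
have Gl : linear G by rewrite /G; lins.
have := congr1 G (coactA (i x)); rewrite !(tsum_fun _ _ Gl) => e.
transitivity (\tsum_(a, b <- coact (i x)) G (a ⊗ Delta b)).
  apply: eq_tsum => a b; rewrite tsum_ten; last by lins.
  by rewrite /G tsum_ten //; lins.
rewrite e; apply: eq_tsum => a b; rewrite (tsum_fun _ _ Gl).
by apply: eq_tsum => c d; rewrite /G tsum_ten //; lins.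
Qed.

Fact retract_counit x : \tsum_(m0, m1 <- delta x) counit m1 *: m0 = x.
Proof.
rewrite /= tsumC; last by lins.
rewrite -[RHS]pK -[in RHS](coact_counit (i x)) (tsum_fun _ _ (f := p)); last by lins.
by apply: eq_tsum => a b; rewrite tsum_ten ?linearZ_LR //; lins.
Qed.

Definition retract_comod : comod H := Comod retract_coactA retract_counit.

Fact retract_incl_colin (x : retract_comod) :
  coact (i x) = \tsum_(m0, m1 <- coact x) (i m0 ⊗ m1).
Proof.
rewrite -ip_coact [RHS]tsumC; last by lins.
by apply: eq_tsum => a b; rewrite tsum_ten //; lins.
Qed.
Definition retract_incl : comodHom retract_comod W :=
  @ComodHom k H retract_comod W i retract_incl_colin.
End Retract.

(** A factorization of the identity through finitely many coordinates, the form in which rationality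
    and tensor products use finite rank. *)
Definition finite_dim (k : fieldType) (F : lmodType k) : Prop :=
  exists (I : finType) (c : I -> {scalar F}) (e : I -> F),
    forall x, x = \sum_i c i x *: e i.

Definition mkscalar (k : fieldType) (V : lmodType k) (f : V -> k) (hf : scalar f) :
  {scalar V} := HB.pack f (GRing.isLinear.Build k V k *%R f hf).

(** Equivalently, the slices [x_0 phi(x_1)], with [phi] a functional on [H], span [W]. Testing
    against linear maps is the form that gives the vanishing of [f] directly. *)
Definition generates (k : fieldType) (H : hopfAlg k) (W : comod H) (x : W) : Prop :=
  forall (U : lmodType k) (f : {linear W -> U}),
    \tsum_(x0, x1 <- coact x) f x0 ⊗ x1 = 0 -> forall y, f y = 0.

(** Local finiteness of comodules: [F] has as basis the first legs of a shortest presentation of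
    [coact w]. Coassociativity makes their span a subcomodule and the counit axiom puts [w] in
    it. *)
Lemma cyclic_cover (k : fieldType) (H : hopfAlg k) (W : comod H) (w : W) :
  exists (F : comod H) (i : comodHom F W) (x : F),
    [/\ i x = w, finite_dim F & generates x].
Proof.
have [n [a [b [phi [psi [ew phiP psiP]]]]]] := tens_dual_bases (coact w).
have incl_lin : linear (fun x : 'rV[k]_n => \sum_j x 0 j *: a j).
  move=> c u v; rewrite scaler_sumr -big_split; apply: eq_bigr => j _ /=.
  by rewrite !mxE scalerDl scalerA.
have proj_lin : linear (fun y : W => \row_j phi j y).
  by move=> c u v; apply/rowP => j; rewrite !mxE linearP.
have [i iE] : exists i : {linear 'rV[k]_n -> W}, forall x, i x = \sum_j x 0 j *: a j.
  by exists (mklin incl_lin).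
have [p pE] : exists p : {linear W -> 'rV[k]_n}, forall y, p y = \row_j phi j y.
  by exists (mklin proj_lin).
have pa j : p (a j) = delta_mx 0 j.
  by rewrite pE; apply/rowP => l; rewrite !mxE phiP eqxx eq_sym.
have ie j : i (delta_mx 0 j) = a j.
  rewrite iE (bigD1 j) //= mxE !eqxx scale1r big1 ?addr0 // => l /negPf lj.
  by rewrite mxE eqxx lj scale0r.
have pK : cancel i p.
  move=> x; rewrite iE linear_sum [RHS]row_sum_delta.
  by apply: eq_bigr => j _; rewrite linearZ_LR /= pa.
(* Applying [psi j] to the last leg of [Σ coact (a l) ⊗ b l = Σ a l ⊗ Delta (b l)] isolates
   [coact (a j)]. *)
have coact_a j : exists h : 'I_n -> H, coact (a j) = \sum_l a l ⊗ h l.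
  have hb : bilin (fun (y : W) (u : tens H H) => y ⊗ (\tsum_(c, d <- u) psi j d *: c)).
    by lins.
  exists (fun l => \tsum_(c, d <- Delta (b l)) psi j d *: c).
  have := congr1 (fun u => \tsum_(y, u <- u) y ⊗ (\tsum_(c, d <- u) psi j d *: c))
    (coactA w).
  rewrite !(tsumC _ _ hb) ew !(lin_sum (tsum_lin _)); try by lins.
  have tl : linear (fun u : tens W (tens H H) =>
    \tsum_(y, u <- u) y ⊗ (\tsum_(c, d <- u) psi j d *: c)) by exact: tsum_lin.
  move=> e.
  transitivity (\sum_(l < n) psi j (b l) *: coact (a l)).
    rewrite (bigD1 j) //= psiP eqxx scale1r big1 ?addr0 // => l lj.
    by rewrite psiP eq_sym (negPf lj) scale0r.
  transitivity (\sum_(l < n) \tsum_(y, u <- a l ⊗ Delta (b l))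
      y ⊗ (\tsum_(c, d <- u) psi j d *: c)); last first.
    by apply: eq_bigr => l _; rewrite tsum_ten.
  transitivity (\sum_(l < n) \tsum_(m0, m1 <- a l ⊗ b l)
    tsum (m0 ⊗ Delta m1) (fun y u => y ⊗ (\tsum_(c, d <- u) psi j d *: c))); last first.
    by apply: eq_bigr => l _; rewrite tsum_ten //; lins; exact: tl.
  rewrite e; apply: eq_bigr => l _.
  rewrite tsum_ten; last by lins; exact: tl.
  rewrite (tsumC _ _ hb) [in LHS](tens_repr (coact (a l))).
  rewrite (tsum_fun _ _ (f := fun z => psi j (b l) *: z)); last by lins.
  apply: eq_tsum => c d; rewrite tsum_ten // tsum_ten; last by lins.
  by rewrite (linZ (tenr _)).
have ip x : \tsum_(c0, c1 <- coact (i x)) i (p c0) ⊗ c1 = coact (i x).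
  rewrite iE linear_sum (lin_sum (tsum_lin _)); last by lins.
  apply: eq_bigr => j _; rewrite linearZ_LR (linZ (tsum_lin _)) /=; last by lins.
  congr (_ *: _); have [h ->] := coact_a j.
  rewrite (lin_sum (tsum_lin _)); last by lins.
  by apply: eq_bigr => l _; rewrite tsum_ten ?pa ?ie //; lins.
have ipw : i (p w) = w.
  rewrite -[in RHS](coact_counit w) ew -[in LHS](coact_counit w) ew.
  rewrite !(lin_sum (tsum_lin _)); try by lins.
  rewrite !linear_sum; apply: eq_bigr => j _.
  by rewrite tsum_ten ?(linearZ_LR p) ?(linearZ_LR i) ?pa ?ie //; lins.
exists (retract_comod pK ip), (retract_incl pK ip), (p w); split=> //.
- have coord_lin j : scalar (fun x : 'rV[k]_n => x 0 j).
    by move=> c u v; rewrite !mxE.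
  exists 'I_n, (fun j => mkscalar (coord_lin j)), (fun j => delta_mx 0 j).
  exact: row_sum_delta.
(* The hypothesis reads [Σ f (p (a l)) ⊗ b l = 0]; slicing it with [psi j] leaves [f] at the [j]-th
   basis vector. *)
- move=> U f; rewrite /= /retract_coact ipw ew tsumC; last by lins.
  rewrite (lin_sum (tsum_lin _)); last by lins.
  move=> e y; rewrite [y]row_sum_delta linear_sum big1 // => j _.
  rewrite linearZ_LR /=.
  have := congr1 (fun u => \tsum_(c, d <- u) psi j d *: c) e.
  rewrite (lin0 (tsum_lin _)); last by lins.
  rewrite (lin_sum (tsum_lin _)); last by lins.
  have slice l : \tsum_(c, d <- \tsum_(c, d <- a l ⊗ b l)
      \tsum_(x0, x1 <- p c ⊗ d) f x0 ⊗ x1) psi j d *: c = psi j (b l) *: f (p (a l)).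
    by rewrite !tsum_ten //; lins.
  rewrite (bigD1 j) //= big1 ?addr0 => [|l lj]; rewrite slice psiP.
    by rewrite eqxx scale1r pa => ->; rewrite scaler0.
  by rewrite eq_sym (negPf lj) scale0r.
Qed.

(** * Linear maps out of finite-dimensional comodules *)

Section FiniteDim.
Variables (k : fieldType) (H : hopfAlgInv k).
Implicit Types (F W V : comod H).

(** By linearity [rho d f x] is the sum of the [c i x *: rho d f (e i)], so the rank-one maps
    [x ↦ c i x *: v] supply the required tensor. *)
Lemma finite_dim_rational d F V (f : {linear F -> V}) : finite_dim F ->
  f \in @ihom_pred k H d F V.
Proof.
move=> [I [c [e ce]]]; apply/asboolP.
have scal_lin (phi : {scalar F}) (v : V) : linear (fun x => phi x *: v) by lins.
exists (\sum_i \tsum_(v, h <- rho d f (e i)) mklin (scal_lin (c i) v) ⊗ h) => x.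
have evb : bilin (fun (g : {linear F -> V}) (h : H) => g x ⊗ h) by lins.
have scb i : bilin (fun v (h : H) => mklin (scal_lin (c i) v) ⊗ h).
  split=> [h|v]; last by lins.
  have ml : linear (fun v => mklin (scal_lin (c i) v)).
    by move=> a u v; apply: linear_eq => y /=; rewrite scalerDr !scalerA mulrC.
  by lins.
rewrite {1}[x]ce (lin_sum (rho_lin d f)) (lin_sum (tsum_lin evb)).
apply: eq_bigr => i _; rewrite (linZ (rho_lin d f)) (tsumC _ _ evb).
rewrite [X in _ *: X]tens_repr (tsum_fun _ _ (f := fun z => c i x *: z)); last by lins.
by apply: eq_tsum => v h; rewrite (tsum_ten _ _ evb) /= (linZ (tenl _)).
Qed.

Definition ihom_fin d F V (fin : finite_dim F) (f : F -> V) (hf : linear f) :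
  ihom_comod d F V := IHom (finite_dim_rational d (mklin hf) fin).

(** Makes the test maps on a tensor product rational when [tau_tensor] is evaluated; the coordinates
    are products of coordinates. *)
Lemma finite_dim_tens (A B : lmodType k) :
  finite_dim A -> finite_dim B -> finite_dim (tens A B).
Proof.
move=> [I [c [a ca]]] [J [e [b eb]]].
have coord_lin i j : scalar (fun z : tens A B => \tsum_(x, y <- z) (c i x * e j y : k^o)).
  have hb : bilin (fun x y => (c i x * e j y : k^o)).
    split=> [y|x] r u v; first by rewrite linearP mulrDl -mulrA.
    by rewrite linearP mulrDr mulrCA.
  by move=> r u v; exact: (tsum_lin hb).
exists (I * J)%type, (fun q => mkscalar (coord_lin q.1 q.2)), (fun q => a q.1 ⊗ b q.2).
apply: (@tens_ext _ _ _ _ id) => [||x y]; first by lins.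
  move=> r u v; rewrite scaler_sumr -big_split; apply: eq_bigr => q _ /=.
  by rewrite coord_lin scalerDl scalerA.
rewrite {1}[x]ca {1}[y]eb (lin_sum (tenl _)).
rewrite -(pair_bigA _ (fun i j => mkscalar (coord_lin i j) (x ⊗ y) *: (a i ⊗ b j))) /=.
apply: eq_bigr => i _; rewrite (lin_sum (tenr _)); apply: eq_bigr => j _ /=.
rewrite tsum_ten; last first.
  split=> [z|z] r u v; first by rewrite linearP mulrDl -mulrA.
  by rewrite linearP mulrDr mulrCA.
by rewrite (linZ (tenl _)) (linZ (tenr _)) scalerA.
Qed.
End FiniteDim.

(** * Direct sums of comodules *)

Section DirectSum.
Variables (k : fieldType) (H : hopfAlg k) (V W : comod H).
Notation VW := (V * W)%type.

Fact inl_lin : linear (fun v : V => (v, 0) : VW).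
Proof. by move=> a u v; congr (_, _); rewrite /= scaler0 addr0. Qed.
Fact inr_lin : linear (fun w : W => (0, w) : VW).
Proof. by move=> a u v; congr (_, _); rewrite /= scaler0 addr0. Qed.
Fact fst_lin : linear (fun x : VW => x.1). Proof. by []. Qed.
Fact snd_lin : linear (fun x : VW => x.2). Proof. by []. Qed.

Definition dsum_coact (x : VW) : tens VW H :=
  (\tsum_(v0, v1 <- coact x.1) ((v0, 0) : VW) ⊗ v1)
  + (\tsum_(w0, w1 <- coact x.2) ((0, w0) : VW) ⊗ w1).
Fact dsum_coact_lin : linear dsum_coact.
Proof.
have l1 := inl_lin; have l2 := inr_lin.
move=> a x y; rewrite /dsum_coact !linearP /= !(tsum_lin _); try by lins.
by rewrite scalerDr addrACA.
Qed.
Lemma dsum_coact_tsum (U : lmodType k) (F : VW -> H -> U) x : bilin F ->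
  tsum (dsum_coact x) F = (\tsum_(v0, v1 <- coact x.1) F (v0, 0) v1)
  + (\tsum_(w0, w1 <- coact x.2) F (0, w0) w1).
Proof.
move=> hF; rewrite (linD (tsum_lin hF)) !(tsumC _ _ hF).
by congr (_ + _); apply: eq_tsum => a b; rewrite (tsum_ten _ _ hF).
Qed.
Let delta := mklin dsum_coact_lin.

Fact dsum_coactA x : \tsum_(m0, m1 <- delta x) (m0 ⊗ Delta m1)
  = \tsum_(m0, m1 <- delta x) \tsum_(n0, n1 <- delta m0) (n0 ⊗ (n1 ⊗ m1)).
Proof.
have l1 := inl_lin; have l2 := inr_lin; have l3 := dsum_coact_lin.
rewrite /= !dsum_coact_tsum; try by lins.
have z (U : lmodType k) (M : comod H) (F : M -> H -> U) :
    bilin F -> tsum (coact (0 : M)) F = 0.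
  by move=> hF; rewrite linear0 (lin0 (tsum_lin hF)).
have split_Delta (y : VW) h : y ⊗ Delta h = \tsum_(c, d <- Delta h) y ⊗ (c ⊗ d).
  by rewrite {1}[Delta h]tens_repr (tsum_fun _ _ (tenr _)).
congr (_ + _).
  under eq_tsum do rewrite split_Delta.
  rewrite (coact_tri (F := fun v c d => ((v, 0) : VW) ⊗ (c ⊗ d))); last by lins.
  apply: eq_tsum => v0 v1; rewrite dsum_coact_tsum; last by lins.
  by rewrite [X in _ + X]z ?addr0 //; lins.
under eq_tsum do rewrite split_Delta.
rewrite (coact_tri (F := fun w c d => ((0, w) : VW) ⊗ (c ⊗ d))); last by lins.
apply: eq_tsum => w0 w1; rewrite dsum_coact_tsum; last by lins.
by rewrite [X in X + _]z ?add0r //; lins.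
Qed.

Fact dsum_counit x : \tsum_(m0, m1 <- delta x) counit m1 *: m0 = x.
Proof.
have l1 := inl_lin; have l2 := inr_lin.
rewrite /= dsum_coact_tsum; last by lins.
rewrite [RHS]surjective_pairing -[X in _ = (X, _)](coact_counit x.1).
rewrite -[X in _ = (_, X)](coact_counit x.2).
transitivity ((\tsum_(v0, v1 <- coact x.1) counit v1 *: v0, 0) +
  (0, \tsum_(w0, w1 <- coact x.2) counit w1 *: w0) : VW).
  rewrite (tsum_fun _ _ inl_lin) (tsum_fun _ _ inr_lin).
  by congr (_ + _); apply: eq_tsum => a b; rewrite -(linZ inl_lin, linZ inr_lin).
by congr (_, _); rewrite /= ?addr0 ?add0r.
Qed.

Definition dsum : comod H := Comod dsum_coactA dsum_counit.

Fact inl_colin v : coact (mklin inl_lin v : dsum)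
  = \tsum_(v0, v1 <- coact v) (mklin inl_lin v0 ⊗ v1).
Proof.
rewrite /= /dsum_coact /= linear0 (lin0 (tsum_lin _)) ?addr0 //.
by have := inr_lin; lins.
Qed.
Fact inr_colin w : coact (mklin inr_lin w : dsum)
  = \tsum_(w0, w1 <- coact w) (mklin inr_lin w0 ⊗ w1).
Proof.
rewrite /= /dsum_coact /= linear0 (lin0 (tsum_lin _)) ?add0r //.
by have := inl_lin; lins.
Qed.
Fact fst_colin (x : dsum) : coact (mklin fst_lin x)
  = \tsum_(x0, x1 <- coact x) (mklin fst_lin x0 ⊗ x1).
Proof.
rewrite /= dsum_coact_tsum; last by lins.
rewrite -tens_repr [X in _ + X](_ : _ = 0) ?addr0 //=.
by rewrite /tsum big1 // => q _; rewrite (lin0 (tenl _)).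
Qed.
Fact snd_colin (x : dsum) : coact (mklin snd_lin x)
  = \tsum_(x0, x1 <- coact x) (mklin snd_lin x0 ⊗ x1).
Proof.
rewrite /= dsum_coact_tsum; last by lins.
rewrite -[X in _ + X]tens_repr [X in X + _](_ : _ = 0) ?add0r //=.
by rewrite /tsum big1 // => q _; rewrite (lin0 (tenl _)).
Qed.
Definition dsum_inl : comodHom V dsum := ComodHom inl_colin.
Definition dsum_inr : comodHom W dsum := ComodHom inr_colin.
Definition dsum_fst : comodHom dsum V := ComodHom fst_colin.
Definition dsum_snd : comodHom dsum W := ComodHom snd_colin.
End DirectSum.

Definition regular_comod (k : fieldType) (H : hopfAlg k) : comod H :=
  Comod (@DeltaA k H) (@counitr k H).

(** * The action attached to an object of the center *)

Section Legs.
Variables (k : fieldType) (H : hopfAlg k).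

Definition legs (U : lmodType k) (W : comod H) (f : W -> U) (x : W) : tens U H :=
  \tsum_(x0, x1 <- coact x) f x0 ⊗ x1.

Lemma legs_lin (U : lmodType k) (W : comod H) (f : {linear W -> U}) : linear (legs f).
Proof. by rewrite /legs; lins. Qed.

Lemma legs_colin (U : lmodType k) (V W : comod H) (i : comodHom V W)
    (f : {linear W -> U}) x :
  legs f (i x) = legs (fun y => f (i y)) x.
Proof.
rewrite /legs comodHomP tsumC; last by lins.
by apply: eq_tsum => a b; rewrite tsum_ten //; lins.
Qed.

(** Take for [F] the subcomodule of [H] generated by [h] and for [phi] the restriction of the
    counit, since [counit h^1 *: h^2 = h]. *)
Lemma coefficient h : exists (F : comod H) (phi : {scalar F}) (x : F),
  finite_dim F /\ \tsum_(x0, x1 <- coact x) phi x0 *: x1 = h.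
Proof.
have [F [i [x [ix fin _]]]] := cyclic_cover (h : regular_comod H).
have phi_lin : scalar (fun y => counit (i y : H)) by move=> a u v; rewrite !linearP.
exists F, (mkscalar phi_lin), x; split=> //.
rewrite -[RHS]counitl -[X in Delta X]ix.
have -> : Delta (i x : H) = coact (i x) by [].
rewrite comodHomP tsumC; last by lins.
by apply: eq_tsum => a b; rewrite tsum_ten //; lins.
Qed.

End Legs.

Section CenterAction.
Variables (k : fieldType) (H : hopfAlgInv k) (M : centerObj H).

Lemma tau_pre (V W : comod H) (i : comodHom V W) (f : W ▷ M) (x : V) :
  tau M V (ihom_pre Left M i f) x = tau M W f (i x).
Proof. exact: (congr1 (fun g : comodHom (W ▷ M) (M ◁ V) => g f x) (tau_natural M i)). Qed.

(** The graph of the future map [M ⊗ H -> M], kept as a relation until it is known to be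
    single-valued and total. *)
Definition transports (u : tens M H) (m : M) : Prop :=
  exists (W : comod H) (f : W ▷ M) (x : W), u = legs f x /\ m = tau M W f x.

(** Both witnesses live on the direct sum: the map [f p1 + g p2] at the point [(a x, y)], with
    naturality along the projections. *)
Lemma transports_lin a u v m n : transports u m -> transports v n ->
  transports (a *: u + v) (a *: m + n).
Proof.
move=> [V [f [x [-> ->]]]] [W [g [y [-> ->]]]].
pose p1 := dsum_fst V W; pose p2 := dsum_snd V W.
exists (dsum V W), (ihom_pre Left M p1 f + ihom_pre Left M p2 g), (a *: x, y).
have e : (a *: x, y) = a *: dsum_inl V W x + dsum_inr V W y :> dsum V W.
  by congr (_, _); rewrite /= ?scaler0 ?addr0 ?add0r.
split; last first.
  rewrite linearD; transitivity (tau M _ (ihom_pre Left M p1 f) (a *: x, y)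
    + tau M _ (ihom_pre Left M p2 g) (a *: x, y)); last by [].
  by rewrite !tau_pre linearZ_LR.
rewrite e legs_lin; congr (_ *: _ + _).
  rewrite legs_colin /legs; apply: eq_tsum => x0 x1; congr (_ ⊗ _).
  transitivity (f x0 + g 0); last by [].
  by rewrite linear0 addr0.
rewrite legs_colin /legs; apply: eq_tsum => x0 x1; congr (_ ⊗ _).
transitivity (f 0 + g x0); last by [].
by rewrite linear0 add0r.
Qed.

(* If f(x_0) ⊗ x_1 = 0, then f vanishes on the subcomodule generated by x. *)
Lemma transports_zero m : transports 0 m -> m = 0.
Proof.
move=> [W [f [x [e ->]]]]; have [F [i [z [iz _ gz]]]] := cyclic_cover x.
rewrite -iz -tau_pre (_ : ihom_pre Left M i f = 0) ?linear0 //.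
by apply: ihom_eq => y; apply: gz; rewrite [RHS]e -iz legs_colin.
Qed.

(** The graph is closed under linear combinations, so being single-valued need only be checked at
    [0]. *)
Lemma transports_fun u m n : transports u m -> transports u n -> m = n.
Proof.
move=> um un; apply/eqP; rewrite -subr_eq0; apply/eqP.
apply: transports_zero; have := transports_lin (-1) un um.
by rewrite !scaleN1r !(addrC (- _)) subrr.
Qed.

Fact rank_one_lin (W : comod H) (phi : {scalar W}) (m : M) :
  linear (fun y => phi y *: m).
Proof. by lins. Qed.

(** The test elements of [W ▷ M]: combined with [coefficient] they realize every pure tensor [m ⊗ h]
    as a value of [legs]. *)
Definition rank_one (W : comod H) (fin : finite_dim W) (phi : {scalar W}) (m : M) :
  W ▷ M := ihom_fin Left fin (rank_one_lin phi m).

Lemma legs_rank_one (F : comod H) (fin : finite_dim F) (phi : {scalar F}) m (x : F) :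
  legs (rank_one fin phi m) x = m ⊗ (\tsum_(x0, x1 <- coact x) phi x0 *: x1).
Proof.
rewrite (tsum_fun _ _ (tenr m)); apply: eq_tsum => a b.
by transitivity ((phi a *: m) ⊗ b); rewrite // (linZ (tenl b)) (linZ (tenr m)).
Qed.

(** Pure tensors are reached by rank-one maps, and sums of them by [transports_lin]. *)
Lemma transports_total u : exists m, transports u m.
Proof.
have z : exists m, transports 0 m.
  by exists (tau M M 0 0), M, 0, 0; rewrite (lin0 (legs_lin _)).
rewrite (tens_repr u) /tsum; elim/big_ind: _ => //.
  move=> v w [m hm] [n hn]; exists (1 *: m + n).
  by rewrite -[v]scale1r; exact: transports_lin.
move=> [m h] _ /=; have [F [phi [x [fin eh]]]] := coefficient h.
exists (tau M F (rank_one fin phi m) x), F, (rank_one fin phi m), x.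
by rewrite legs_rank_one eh.
Qed.

Definition transport (u : tens M H) : M := projT1 (cid (transports_total u)).
Lemma transport_linear : linear transport.
Proof.
move=> a u v; apply: transports_fun (projT2 (cid (transports_total _))) _.
by apply: transports_lin; exact: (projT2 (cid (transports_total _))).
Qed.

Lemma transportE (W : comod H) (f : W ▷ M) x : transport (legs f x) = tau M W f x.
Proof.
by apply: transports_fun (projT2 (cid (transports_total _))) _; exists W, f, x.
Qed.

Definition center_act (h : H) (m : M) : M := transport (m ⊗ h).

Lemma center_act_bilin : bilin center_act.
Proof.
by split=> [m|h] a u v; rewrite /center_act ?tenl ?tenr transport_linear.
Qed.

(** Recovers [tau] from the action, which settles the round trip starting from the center. *)
Lemma tau_center_act (W : comod H) (f : W ▷ M) x :
  tau M W f x = \tsum_(x0, x1 <- coact x) center_act x1 (f x0).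
Proof. by rewrite -transportE (tsum_fun _ _ transport_linear). Qed.

Lemma tau_rank_one (F : comod H) (fin : finite_dim F) (phi : {scalar F}) m (x : F) :
  tau M F (rank_one fin phi m) x
  = center_act (\tsum_(x0, x1 <- coact x) phi x0 *: x1) m.
Proof. by rewrite -transportE legs_rank_one. Qed.

(** The map [c ↦ c m] on the unit comodule has [legs] equal to [m ⊗ 1] at [1], and [tau_unit] fixes
    its value there. *)
Lemma center_act1 m : center_act 1 m = m.
Proof.
have [f fE] : exists f : unit_comod H ▷ M, forall c, f c = (c : k) *: m.
  by exists (ihom_lift (@cst_unit_bilin k H M) (@cst_unit_colin k H Left M) m).
have e : tau M _ f (1 : unit_comod H) = f (1 : unit_comod H).
  exact: (congr1 (fun g : comodHom (unit_comod H ▷ M) M => g f) (tau_unit M)).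
move: e; rewrite -transportE fE scale1r => e; rewrite -[RHS]e; congr transport.
rewrite /legs [coact _](_ : _ = (1 : unit_comod H) ⊗ (1 : H)) //.
by rewrite tsum_ten ?fE ?scale1r //; lins.
Qed.

(** With [g] and [h] written as coefficients of [W] and [V], [tau_tensor] is evaluated on
    [phi ⊗ psi ⊗ m] at [w ⊗ v]: one side gives the action of [g h], the other that of [h] followed
    by [g]. *)
Lemma center_actM g h m : center_act (g * h) m = center_act g (center_act h m).
Proof.
have [W [phi [w [finW eg]]]] := coefficient g.
have [V [psi [v [finV eh]]]] := coefficient h.
have f_lin : linear (fun z : tens_comod W V =>
    \tsum_(x, y <- z) phi x *: (psi y *: m)).
  by lins.
pose f : tens_comod W V ▷ M := 
    @ihom_fin k H Left (tens_comod W V) M (finite_dim_tens finW finV) _ f_lin.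
have fE x y : f (x ⊗ y) = phi x *: (psi y *: m) by rewrite /= tsum_ten //; lins.
pose E : comod H := (M ◁ W) ◁ V.
have := congr1 (fun g : comodHom (tens_comod W V ▷ M) E => g f v w) (tau_tensor M W V).
have -> : comod_comp (curry Right V W M) (tau M (tens_comod W V)) f v w
    = tau M (tens_comod W V) f (w ⊗ v) by exact: (@curryE k H Right).
set f' := comod_comp (ihom_post Left W (tau M V)) (curry Left W V M) f.
(* The inner [tau M V] has already produced [h m], so the outer [tau M W] meets a rank-one map
   again. *)
have f'E : flip W V M f' v = rank_one finW phi (center_act h m).
  apply: ihom_eq => x; rewrite flipE.
  transitivity (tau M V (curry Left W V M f x) v); first by [].
  rewrite (_ : curry Left W V M f x = phi x *: rank_one finV psi m).
    by rewrite linearZ_LR; transitivity (phi x *: tau M V (rank_one finV psi m) v);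
      rewrite // tau_rank_one eh.
  by apply: ihom_eq => y; rewrite curryE [LHS]fE.
have -> : comod_comp (ihom_post Right V (tau M W)) (comod_comp (flip W V M)
    (comod_comp (ihom_post Left W (tau M V)) (curry Left W V M))) f v w
  = tau M W (flip W V M f' v) w by [].
rewrite f'E tau_rank_one eg => <-; rewrite -transportE; congr transport.
rewrite /legs [coact _]tens_coactE tsumC; last by lins.
(* The coaction of [w ⊗ v] multiplies the [H]-legs, whence [m ⊗ (g * h)]. *)
transitivity (m ⊗ (\tsum_(w0, w1 <- coact w) \tsum_(v0, v1 <- coact v)
    (phi w0 *: w1) * (psi v0 *: v1))).
  rewrite -eg -eh; congr (_ ⊗ _).
  rewrite [LHS](tsum_fun _ _ (f := fun x => x * _)); last by lins.
  apply: eq_tsum => w0 w1.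
  by rewrite [LHS](tsum_fun _ _ (f := fun x => _ * x)) //; lins.
rewrite (tsum_fun _ _ (tenr m)); apply: eq_tsum => w0 w1.
rewrite (tsum_fun _ _ (tenr m)) tsumC; last by lins.
apply: eq_tsum => v0 v1; rewrite tsum_ten; last by lins.
by rewrite fE -scalerAl -scalerAr !(linZ (tenr _)) !(linZ (tenl _)).
Qed.

Ltac lina := repeat first [ lin4 | lazymatch goal with |- linear _ => first
  [ apply: (lin_bill _ center_act_bilin) | apply: (lin_bilr _ center_act_bilin) ] end ].

(** With [h] a coefficient, [h m] is [tau f w] for a rank-one [f]. Colinearity of [tau] brings in
    the coaction of [f], and the antipode in [rho Left f] becomes the factor [S(h^1)]. *)
Lemma coact_center_act h m : coact (center_act h m) =
  \tsum_(h12, h3 <- Delta h) \tsum_(h1, h2 <- Delta h12)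
    \tsum_(m0, m1 <- coact m) (center_act h2 m0 ⊗ (h3 * m1 * antipode h1)).
Proof.
have [W [phi [w [finW eh]]]] := coefficient h.
pose f := rank_one finW phi m.
have fE x : f x = phi x *: m by [].
(* The arguments [a], [c], [d] stand for the three legs of [h]. *)
pose F a c d := \tsum_(m0, m1 <- coact m) (center_act c m0 ⊗ (d * m1 * antipode a)).
have Ftri : trilin F by rewrite /F; lina.
pose T x := \tsum_(a, b <- Delta x) \tsum_(c, d <- Delta b) F a c d.
have Tl : linear T by rewrite /T /F; lina.
transitivity (T h); last exact: Delta_tri.
rewrite -{2}eh (tsum_fun _ _ Tl) -{1}eh -tau_rank_one -/f.
(* [coact_ihom] expands the coaction of the value, and colinearity of [tau] moves it onto [f]. *)
rewrite (coact_ihom (tau M W f) w) comodHomP tsumC; last by linh.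
transitivity (\tsum_(w0, w1 <- coact w) \tsum_(c, d <- Delta w1)
   \tsum_(g, x <- coact f) center_act c (g w0) ⊗ (d * x)).
  transitivity (\tsum_(g, x <- coact f) \tsum_(w0, w1 <- coact w)
   \tsum_(c, d <- Delta w1) center_act c (g w0) ⊗ (d * x)); last first.
    rewrite tsum_swap; apply: eq_tsum => w0 w1.
    by rewrite tsum_swap.
  apply: eq_tsum => g x; rewrite tsum_ten; last by linh.
  rewrite (coact_tri (F := fun w0 c d => center_act c (g w0) ⊗ (d * x))); last first.
    by lina.
  apply: eq_tsum => w0 w1 /=.
  by rewrite tau_center_act (tsum_fun _ _ (f := fun y => y ⊗ (w1 * x))) //; lins.
transitivity (\tsum_(w0, w1 <- coact w) \tsum_(y0, y1 <- coact w0)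
   \tsum_(c, d <- Delta w1) phi y0 *: F y1 c d).
  apply: eq_tsum => w0 w1; rewrite [RHS]tsum_swap; apply: eq_tsum => c d.
  rewrite (tsum_ihom_coact f w0 (F := fun v x => center_act c v ⊗ (d * x))); last by lina.
  rewrite tsum_rho; last by lina.
  apply: eq_tsum => y0 y1; rewrite fE linearZ_LR (linZ (tsum_lin _)); last by lina.
  by congr (_ *: _); apply: eq_tsum => m0 m1; rewrite /= mulrA.
rewrite -(coact_tri (F := fun y0 y1 w1 => \tsum_(c, d <- Delta w1) phi y0 *: F y1 c d)).
  apply: eq_tsum => w0 w1; rewrite (linZ Tl).
  rewrite /T (tsum_fun _ _ (f := fun z => phi w0 *: z)); last by lins.
  apply: eq_tsum => a b.
  by rewrite (tsum_fun _ _ (f := fun z => phi w0 *: z)) //; lins.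
by rewrite /F; lina.
Qed.

Definition center_aYD : aYD H :=
  @AYD k H M center_act center_act_bilin center_act1 center_actM coact_center_act.
End CenterAction.

(** * The central structure of an anti-Yetter-Drinfeld module *)

(** The last two legs cancel: [h^2 S(h^3)] on the left, [S^-1(h^3) h^2] on the right. This is the
    cancellation behind the colinearity of [tau] and of its inverse. *)
Lemma Delta_twist_cancel (k : fieldType) (H : hopfAlgInv k) d (U : lmodType k)
    (P : H -> H -> U) (h : H) : bilin P ->
  \tsum_(b, c <- Delta h) \tsum_(p, q <- Delta b) P p (twist d q c) = P h 1.
Proof.
move=> hP; have [Pl Pr] := hP.
rewrite -(Delta_tri (F := fun p q c => P p (twist d q c))); last first.
  split=> [b c|a c|a b]; first exact: Pl.
    by move=> x u v; rewrite (proj1 (twist_bilin _ d)) Pr.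
  by move=> x u v; rewrite (proj2 (twist_bilin _ d)) Pr.
rewrite -[in RHS](counitr h) (tsum_fun _ _ (Pl 1)); apply: eq_tsum => a b.
rewrite -(tsum_fun _ _ (Pr a)) (linZ (Pl 1)) -(linZ (Pr a)); congr (P a _).
rewrite -(twist_smull d 1 b); apply: eq_tsum => c e; congr twist.
by case: d => /=; rewrite ?mul1r ?mulr1.
Qed.

Section AYDCenter.
Variables (k : fieldType) (H : hopfAlgInv k) (M : aYD H).
Notation V := (@antipodeV k H).

Ltac lina := repeat first [ lin4 | lazymatch goal with |- linear _ => first
  [ apply: (lin_bill _ (@act_bilin _ _ M)) | apply: (lin_bilr _ (@act_bilin _ _ M)) ] end ].

Definition aYD_tau (W : comod H) (f : W -> M) (w : W) : M :=
  \tsum_(w0, w1 <- coact w) act w1 (f w0).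

Definition aYD_tauV (W : comod H) (f : W -> M) (w : W) : M :=
  \tsum_(w0, w1 <- coact w) act (V w1) (f w0).

Lemma aYD_tau_bilin d (W : comod H) : bilin (fun (f : ihom_comod d W M) => aYD_tau f).
Proof. by rewrite /aYD_tau; lina. Qed.
Lemma aYD_tauV_bilin d (W : comod H) : bilin (fun (f : ihom_comod d W M) => aYD_tauV f).
Proof. by rewrite /aYD_tauV; lina. Qed.

(** In [rho Right] the factor [S^-1] cancels the third leg of the aYD formula. What remains is
    [w_2 f(w_0)_0 ⊗ f(w_0)_1 S(w_1)], that is, [tau] applied to [rho Left f]. *)
Lemma aYD_tau_colin (W : comod H) (f : W ▷ M) w :
  rho Right (aYD_tau f) w = \tsum_(g, h <- coact f) (aYD_tau g w ⊗ h).
Proof.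
pose G w0 h12 x := \tsum_(h1, h2 <- Delta h12) \tsum_(m0, m1 <- coact (f w0))
  act h2 m0 ⊗ (x * m1 * antipode h1).
have Gtri : trilin G by rewrite /G; lina.
transitivity (\tsum_(w0, w1 <- coact w) \tsum_(a, b <- coact w0)
    \tsum_(p, q <- Delta b) G a p (twist Right q w1)).
  rewrite /rho; apply: eq_tsum => w0 w1.
  rewrite [aYD_tau f w0]/aYD_tau (tsum_fun _ _ (f := fun m => \tsum_(v0, v1 <- coact m)
    v0 ⊗ twist Right v1 w1)); last by lina.
  apply: eq_tsum => a b; rewrite act_coact tsumC; last by lina.
  apply: eq_tsum => p q; rewrite tsumC; last by lina.
  apply: eq_tsum => h1 h2; rewrite tsumC; last by lina.
  by apply: eq_tsum => m0 m1; rewrite tsum_ten /= ?mulrA //; lina.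
rewrite -(coact_tri (F := fun a b w1 => \tsum_(p, q <- Delta b) G a p (twist Right q w1)));
  last by case: Gtri => *; lint; auto.
transitivity (\tsum_(w0, w1 <- coact w) G w0 w1 1).
  apply: eq_tsum => w0 w1.
  by rewrite (@Delta_twist_cancel _ _ Right _ (G w0)) //; case: Gtri.
(* Regrouping the legs lets [S(y1)] join the coaction of [f y0] to form [rho Left f w0]. *)
transitivity (\tsum_(w0, w1 <- coact w) \tsum_(y0, y1 <- coact w0)
    \tsum_(m0, m1 <- coact (f y0)) act w1 m0 ⊗ (m1 * antipode y1)).
  rewrite -(coact_tri (F := fun y0 y1 w1 => \tsum_(m0, m1 <- coact (f y0))
     act w1 m0 ⊗ (m1 * antipode y1))); last by lina.
  apply: eq_tsum => w0 w1; apply: eq_tsum => h1 h2; apply: eq_tsum => m0 m1.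
  by rewrite mul1r.
transitivity (\tsum_(w0, w1 <- coact w) \tsum_(g, h <- coact f) act w1 (g w0) ⊗ h).
  apply: eq_tsum => w0 w1.
  rewrite (tsum_ihom_coact f w0 (F := fun v h => act w1 v ⊗ h)); last by lina.
  by rewrite tsum_rho //; lina.
rewrite tsum_swap; apply: eq_tsum => g h.
by rewrite /aYD_tau (tsum_fun _ _ (f := fun m => m ⊗ h)) //; lina.
Qed.

(** [S^-1] reverses the three legs of [h], and the antipode of the aYD condition cancels the [S^-1]
    on the last one. *)
Lemma coact_actV h (m : M) : coact (act (V h) m) =
  \tsum_(q, s <- Delta h) \tsum_(p, r <- Delta q)
    \tsum_(m0, m1 <- coact m) (act (V r) m0 ⊗ (V p * m1 * s)).
Proof.
rewrite act_coact Delta_antipodeV tsumC; last by lina.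
rewrite -(Delta_tri (F := fun p r s => \tsum_(m0, m1 <- coact m)
  (act (V r) m0 ⊗ (V p * m1 * s)))); last by lina.
apply: eq_tsum => p q; rewrite tsum_ten; last by lina.
rewrite Delta_antipodeV tsumC; last by lina.
apply: eq_tsum => r s; rewrite tsum_ten; last by lina.
by rewrite antipodeVK.
Qed.

(** Mirror image of [aYD_tau_colin]: by [coact_actV] the antipode of [rho Left] now cancels a leg on
    the right, leaving [rho Right f]. *)
Lemma aYD_tauV_colin (W : comod H) (f : M ◁ W) w :
  rho Left (aYD_tauV f) w = \tsum_(g, h <- coact f) (aYD_tauV g w ⊗ h).
Proof.
pose G w0 q x := \tsum_(p, r <- Delta q) \tsum_(m0, m1 <- coact (f w0))
  act (V r) m0 ⊗ (V p * m1 * x).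
have Gtri : trilin G by rewrite /G; lina.
transitivity (\tsum_(w0, w1 <- coact w) \tsum_(a, b <- coact w0)
    \tsum_(q, s <- Delta b) G a q (twist Left s w1)).
  rewrite /rho; apply: eq_tsum => w0 w1.
  rewrite [aYD_tauV f w0]/aYD_tauV (tsum_fun _ _ (f := fun m => \tsum_(v0, v1 <- coact m)
    v0 ⊗ twist Left v1 w1)); last by lina.
  apply: eq_tsum => a b; rewrite coact_actV tsumC; last by lina.
  apply: eq_tsum => q s; rewrite tsumC; last by lina.
  apply: eq_tsum => p r; rewrite tsumC; last by lina.
  by apply: eq_tsum => m0 m1; rewrite tsum_ten /= ?mulrA //; lina.
rewrite -(coact_tri (F := fun a b w1 => \tsum_(q, s <- Delta b) G a q (twist Left s w1)));
  last by case: Gtri => *; lint; auto.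
transitivity (\tsum_(w0, w1 <- coact w) G w0 w1 1).
  apply: eq_tsum => w0 w1.
  by rewrite (@Delta_twist_cancel _ _ Left _ (G w0)) //; case: Gtri.
transitivity (\tsum_(w0, w1 <- coact w) \tsum_(y0, y1 <- coact w0)
    \tsum_(m0, m1 <- coact (f y0)) act (V w1) m0 ⊗ (V y1 * m1)).
  rewrite -(coact_tri (F := fun y0 y1 w1 => \tsum_(m0, m1 <- coact (f y0))
     act (V w1) m0 ⊗ (V y1 * m1))); last by lina.
  apply: eq_tsum => w0 w1; apply: eq_tsum => h1 h2; apply: eq_tsum => m0 m1.
  by rewrite mulr1.
transitivity (\tsum_(w0, w1 <- coact w) \tsum_(g, h <- coact f) act (V w1) (g w0) ⊗ h).
  apply: eq_tsum => w0 w1.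
  rewrite (tsum_ihom_coact f w0 (F := fun v h => act (V w1) v ⊗ h)); last by lina.
  by rewrite tsum_rho //; lina.
rewrite tsum_swap; apply: eq_tsum => g h.
by rewrite /aYD_tauV (tsum_fun _ _ (f := fun m => m ⊗ h)) //; lina.
Qed.

Lemma act_scal1 c (m : M) : act (c *: 1) m = c *: m.
Proof. by rewrite (linZ (proj1 (@act_bilin _ _ M) m)) act1. Qed.

(** Rests on [S^-1(h^2) h^1 = counit h]; the other composite rests on [h^2 S^-1(h^1) = counit h]. *)
Lemma aYD_tauK d (W : comod H) (f : ihom_comod d W M) : aYD_tauV (aYD_tau f) =1 f.
Proof.
move=> w; rewrite /aYD_tauV /aYD_tau.
transitivity (\tsum_(w0, w1 <- coact w) \tsum_(a, b <- coact w0)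
    act (V w1 * b) (f a)).
  apply: eq_tsum => w0 w1; rewrite (tsum_fun _ _ (f := act (V w1))); last by lina.
  by apply: eq_tsum => a b; rewrite actM.
rewrite -(coact_tri (F := fun a b c => act (V c * b) (f a))); last by lina.
rewrite -[in RHS](coact_counit w) (tsum_fun _ _ (f := f)); last by lins.
apply: eq_tsum => w0 w1.
rewrite -(tsum_fun _ _ (f := fun x => act x (f w0))); last by lina.
by rewrite antipodeVl act_scal1 linearZ.
Qed.

Lemma aYD_tauVK d (W : comod H) (f : ihom_comod d W M) : aYD_tau (aYD_tauV f) =1 f.
Proof.
move=> w; rewrite /aYD_tauV /aYD_tau.
transitivity (\tsum_(w0, w1 <- coact w) \tsum_(a, b <- coact w0)
    act (w1 * V b) (f a)).
  apply: eq_tsum => w0 w1; rewrite (tsum_fun _ _ (f := act w1)); last by lina.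
  by apply: eq_tsum => a b; rewrite actM.
rewrite -(coact_tri (F := fun a b c => act (c * V b) (f a))); last by lina.
rewrite -[in RHS](coact_counit w) (tsum_fun _ _ (f := f)); last by lins.
apply: eq_tsum => w0 w1.
rewrite -(tsum_fun _ _ (f := fun x => act x (f w0))); last by lina.
by rewrite antipodeVr act_scal1 linearZ.
Qed.

Definition aYD_braid (W : comod H) : comodHom (W ▷ M) (M ◁ W) :=
  ihom_lift (@aYD_tau_bilin Left W) (@aYD_tau_colin W).

Fact aYD_braid_iso W : is_comod_iso (aYD_braid W).
Proof.
exists (ihom_lift (@aYD_tauV_bilin Right W) (@aYD_tauV_colin W)).
by split; apply: comodHom_eq => f; apply: ihom_eq => w; [exact: aYD_tauK|exact: aYD_tauVK].
Qed.

Fact aYD_braid_natural (W' W : comod H) (e : comodHom W' W) :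
  comod_comp (aYD_braid W') (ihom_pre Left M e)
  = comod_comp (ihom_pre Right M e) (aYD_braid W).
Proof.
apply: comodHom_eq => f; apply: ihom_eq => w.
transitivity (aYD_tau (fun x => f (e x)) w); first by [].
transitivity (aYD_tau f (e w)); last by [].
rewrite /aYD_tau comodHomP tsumC; last by lina.
by apply: eq_tsum => a b; rewrite tsum_ten //; lina.
Qed.

Fact aYD_braid_unit : comod_comp (ev_unit Right M) (aYD_braid (unit_comod H))
  = ev_unit Left M.
Proof.
apply: comodHom_eq => f; transitivity (aYD_tau f (1 : unit_comod H)); first by [].
by rewrite /aYD_tau [LHS]tsum_ten ?act1 //; lina.
Qed.

Fact aYD_braid_tensor (W X : comod H) :
  comod_comp (curry Right X W M) (aYD_braid (tens_comod W X))
  = comod_comp (ihom_post Right X (aYD_braid W))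
      (comod_comp (flip W X M)
         (comod_comp (ihom_post Left W (aYD_braid X)) (curry Left W X M))).
Proof.
apply: comodHom_eq => f; apply: ihom_eq => x; apply: ihom_eq => w.
transitivity (aYD_tau f (w ⊗ x)); first exact: (@curryE k H Right).
set f' := comod_comp (ihom_post Left W (aYD_braid X)) (curry Left W X M) f.
transitivity (aYD_tau (flip W X M f' x) w); last by [].
rewrite /aYD_tau [coact _]tens_coactE tsumC; last by lina.
apply: eq_tsum => w0 w1; rewrite tsumC; last by lina.
rewrite flipE.
transitivity (act w1 (aYD_tau (curry Left W X M f w0) x)); last by [].
rewrite /aYD_tau (tsum_fun _ _ (f := act w1)); last by lina.
by apply: eq_tsum => x0 x1; rewrite tsum_ten ?actM ?curryE //; lina.
Qed.

Definition aYD_center : centerObj H :=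
  @CenterObj k H M aYD_braid aYD_braid_iso aYD_braid_natural aYD_braid_unit
    aYD_braid_tensor.
End AYDCenter.

(** * The equivalence *)

Section Equivalence.
Variables (k : fieldType) (H : hopfAlgInv k).

(** Stated for any [A] expressing [tau], so that it applies both to [act] and to [center_act]. *)
Lemma hom_transport_id (M : centerObj H) (A : H -> M -> M) :
  (forall (W : comod H) (f : W ▷ M) w,
     tau M W f w = \tsum_(w0, w1 <- coact w) A w1 (f w0)) ->
  forall m, hom_transport (comod_id M) m = \tsum_(m0, m1 <- coact m) A m1 m0.
Proof.
move=> tauE m.
pose f := adj (comod_comp (comod_id M) (unitor Left M)) (1 : unit_comod H).
have fE x : f x = x by rewrite [LHS](@unitorE k H Left) scale1r.
transitivity (tau M M f m); first exact: (@adjVE k H Right).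
by rewrite tauE; apply: eq_tsum => m0 m1; rewrite fE.
Qed.

(** Both actions agree on coefficients, where [tau] of a rank-one map is explicit; this settles the
    round trip starting from aYD modules. *)
Lemma center_act_aYD (M : aYD H) h m :
  center_act (M := aYD_center M) h m = act h m.
Proof.
have [W [phi [w [finW <-]]]] := @coefficient k H h.
rewrite -(@tau_rank_one k H (aYD_center M) W finW).
have [actl actr] := @act_bilin _ _ M.
rewrite (tsum_fun _ _ (actl m)).
transitivity (\tsum_(w0, w1 <- coact w) act w1 (phi w0 *: m)); first by [].
by apply: eq_tsum => w0 w1; rewrite (linZ (actl m)) (linZ (actr w1)).
Qed.

(** Composing [th] with the rank-one map at [m] gives the rank-one map at [th m], so compatibility
    with [tau] on these maps is [H]-linearity. *)
Lemma centerHom_act (M N : centerObj H) (th : centerHom M N) h m :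
  th (center_act h m) = center_act h (th m).
Proof.
have [W [phi [w [finW <-]]]] := @coefficient k H h.
rewrite -!(tau_rank_one finW).
have thZ : ihom_post Left W th (rank_one finW phi m) = rank_one finW phi (th m).
  by apply: ihom_eq => x; exact: (linearZ_LR th).
rewrite -thZ.
exact: (congr1 (fun g : comodHom (W ▷ M) (N ◁ W) => g (rank_one finW phi m) w)
  (centerHomP th W)).
Qed.

Lemma aYDHom_center (M N : aYD H) (th : aYDHom M N) (W : comod H) :
  comod_comp (ihom_post Right W th) (tau (aYD_center M) W)
  = comod_comp (tau (aYD_center N) W) (ihom_post Left W th).
Proof.
apply: comodHom_eq => f; apply: ihom_eq => w.
transitivity (th (aYD_tau f w)); first by [].
transitivity (aYD_tau (fun x => th (f x)) w); last by [].
rewrite /aYD_tau (tsum_fun _ _ (f := th)); last by lins.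
by apply: eq_tsum => w0 w1; rewrite aYDHomP.
Qed.

Lemma stable_center (M : aYD H) : stable M ->
  hom_transport (comod_id (aYD_center M)) = comod_id (aYD_center M).
Proof.
move=> st; apply: comodHom_eq => m.
by rewrite (@hom_transport_id (aYD_center M) (@act k H M)) //; exact: st.
Qed.

Lemma center_stable (M : centerObj H) :
  hom_transport (comod_id M) = comod_id M -> stable (center_aYD M).
Proof.
move=> e m; have := congr1 (fun g : comodHom M M => g m) e.
by rewrite (@hom_transport_id M (@center_act k H M)) //; exact: tau_center_act.
Qed.
(** Both functors keep the underlying comodules and linear maps, so their laws reduce to pointwise
    equalities. *)
Definition saYD_to_center : functor (saYD_cat H) (center'_cat H).
Proof.
refine (@Functor (saYD_cat H) (center'_cat H)
  (fun M => exist _ (aYD_center (sval M)) (stable_center (svalP M)))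
  (fun M N th => @CenterHom k H (aYD_center (sval M)) (aYD_center (sval N)) th
     (aYDHom_center th)) _ _) => *; exact: centerHom_eq.
Defined.

Definition center_to_saYD : functor (center'_cat H) (saYD_cat H).
Proof.
refine (@Functor (center'_cat H) (saYD_cat H)
  (fun M => exist _ (center_aYD (sval M)) (center_stable (svalP M)))
  (fun M N th => @AYDHom k H (center_aYD (sval M)) (center_aYD (sval N)) th
     (centerHom_act th)) _ _) => *; exact: aYDHom_eq.
Defined.

(** The round trip changes only the presentation of the action, so the identity map is [H]-linear
    both ways by [center_act_aYD]. *)
Lemma saYD_center_saYD :
  nat_isomorphic (functor_comp center_to_saYD saYD_to_center) (functor_id (saYD_cat H)).
Proof.
pose M' (M : aYD H) := center_aYD (aYD_center M).
have eta_act (M : aYD H) h (m : M' M) : comod_id M (act h m) = act h (comod_id M m).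
  exact: center_act_aYD.
have etaV_act (M : aYD H) h (m : M) :
    comod_id M (act h m) = act (a := M' M) h (comod_id M m).
  by rewrite -center_act_aYD.
pose eta (M : saYD_cat H) : aYDHom (M' (sval M)) (sval M) :=
  @AYDHom k H (M' (sval M)) (sval M) (comod_id (sval M)) (@eta_act (sval M)).
pose etaV (M : saYD_cat H) : aYDHom (sval M) (M' (sval M)) :=
  @AYDHom k H (sval M) (M' (sval M)) (comod_id (sval M)) (@etaV_act (sval M)).
exists eta; split=> [M|M N th]; last exact: aYDHom_eq.
by exists (etaV M); split; exact: aYDHom_eq.
Qed.

(** Here the identity map commutes with the old and the new [tau] because [tau_center_act] makes
    them agree pointwise. *)
Lemma center_saYD_center :
  nat_isomorphic (functor_comp saYD_to_center center_to_saYD)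
    (functor_id (center'_cat H)).
Proof.
pose M' (M : centerObj H) := aYD_center (center_aYD M).
have tauE (M : centerObj H) (W : comod H) (f : W ▷ M) : tau (M' M) W f = tau M W f.
  by apply: ihom_eq => w; exact: (esym (tau_center_act f w)).
have eta_tau (M : centerObj H) (W : comod H) :
    comod_comp (ihom_post Right W (comod_id M)) (tau (M' M) W)
    = comod_comp (tau M W) (ihom_post Left W (comod_id M)).
  by rewrite !ihom_post_id; apply: comodHom_eq => f; exact: tauE.
have etaV_tau (M : centerObj H) (W : comod H) :
    comod_comp (ihom_post Right W (comod_id M)) (tau M W)
    = comod_comp (tau (M' M) W) (ihom_post Left W (comod_id M)).
  by rewrite !ihom_post_id; apply: comodHom_eq => f; rewrite [RHS]tauE.
pose eta (M : center'_cat H) : centerHom (M' (sval M)) (sval M) :=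
  @CenterHom k H (M' (sval M)) (sval M) (comod_id (sval M)) (eta_tau (sval M)).
pose etaV (M : center'_cat H) : centerHom (sval M) (M' (sval M)) :=
  @CenterHom k H (sval M) (M' (sval M)) (comod_id (sval M)) (etaV_tau (sval M)).
exists eta; split=> [M|M N th]; last exact: centerHom_eq.
by exists (etaV M); split; exact: centerHom_eq.
Qed.
End Equivalence.

Theorem corollary2p8 (k : fieldType) (hk : [pchar k] =i pred0)
    (H : hopfAlgInv k) :
  equivalent (saYD_cat H) (center'_cat H).
Proof.
exists (saYD_to_center H), (center_to_saYD H); split.
  exact: saYD_center_saYD.
exact: center_saYD_center.
Qed.
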